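(* Let $\mathbf S=(S_1,\dots,S_k)$ be a partition of $[n]$ into nonempty blocks, let $\Delta(\mathbf S)=\prod_{i=1}^k\Delta(S_i)\subset\mathbb R^n$ be the associated product of standard simplices, and let $\Psi$ be the barycentric subdivision of the normal fan of $\Delta(\mathbf S)$. The indecomposable factors of the deep truncations and of the fragments of $\Delta(\mathbf S)$, together with the simplicial bases for each factor, give a pair of indecomposable polytopal bases for the deformation cone of $\Psi$. Precisely, each of the two collections $$\left\{\operatorname{DTr}\left[\Delta(\mathbf T_{\mathbf A}),\Delta(\mathbf A|_{\mathbf T_{\mathbf A}})\right] : \mathbf A \text{ a valid tuple with } \mathrm{slk}(\mathbf A)>1\right\}\cup\left\{\Delta(I) : \emptyset\subsetneq I\subseteq S_i,\ i\in[k]\right\}$$ and $$\left\{\operatorname{Fr}\left[\Delta(\mathbf T_{\mathbf A}),\Delta(\mathbf A|_{\mathbf T_{\mathbf A}})\right] : \mathbf A \text{ a valid tuple with } \mathrm{slk}(\mathbf A)>1\right\}\cup\left\{\Delta(I) : \emptyset\subsetneq I\subseteq S_i,\ i\in[k]\right\}$$ is an indecomposable polytopal basis for the deformation cone of $\Psi$.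
   Context: Notation. For a finite set $I$, $\Delta(I)=\operatorname{conv}\{e_s:s\in I\}\subset\mathbb R^I$ (also viewed in $\mathbb R^n$ by extending by zero when $I\subseteq[n]$). More generally, for a tuple of pairwise disjoint nonempty sets $\mathbf T=(T_1,\dots,T_m)$, $\Delta(\mathbf T)=\prod_j\Delta(T_j)$, viewed in $\mathbb R^n$ by extending by zero in the remaining coordinates. A tuple $\mathbf A=(A_1,\dots,A_k)$ is valid (for $\mathbf S$) if $\emptyset\neq A_i\subseteq S_i$ for all $i$; valid tuples correspond to the nonempty faces $\Delta(\mathbf A)=\prod\Delta(A_i)$ of $\Delta(\mathbf S)$. Put $\overline{\mathbf A}=\bigcup_iS_i\setminus\bigcup_iA_i$ and $u_{\mathbf A}=\sum_{s\in\overline{\mathbf A}}e_s$. For $\mathbf A\ne\mathbf S$, the deep truncation and the fragment of $\Delta(\mathbf S)$ along $\Delta(\mathbf A)$ are $\operatorname{DTr}[\Delta(\mathbf S),\Delta(\mathbf A)]=\{x\in\Delta(\mathbf S): u_{\mathbf A}\cdot x\ge1\}$ and $\operatorname{Fr}[\Delta(\mathbf S),\Delta(\mathbf A)]=\{x\in\Delta(\mathbf S): u_{\mathbf A}\cdot x\le1\}$. (The functional $u_{\mathbf A}$ is $0$ on the face $\Delta(\mathbf A)$ and $1$ on every vertex adjacent to it.) Slack: $\mathrm{Slk}(\mathbf A)=\{i : A_i\ne S_i\}$, $\mathrm{slk}(\mathbf A)=|\mathrm{Slk}(\mathbf A)|$. $\mathbf T_{\mathbf A}=(S_i)_{i\in\mathrm{Slk}(\mathbf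 A)}$ and $\mathbf A|_{\mathbf T_{\mathbf A}}=(A_i)_{i\in\mathrm{Slk}(\mathbf A)}$; for $\mathbf A\ne\mathbf S$, the truncation and fragment for $\mathbf T_{\mathbf A}$ are $\operatorname{DTr}[\Delta(\mathbf T_{\mathbf A}),\Delta(\mathbf A|_{\mathbf T_{\mathbf A}})]=\{x\in\Delta(\mathbf T_{\mathbf A}): \sum_{i\in\mathrm{Slk}(\mathbf A)}\sum_{s\in S_i\setminus A_i}x_s\ge1\}$ and $\operatorname{Fr}[\Delta(\mathbf T_{\mathbf A}),\Delta(\mathbf A|_{\mathbf T_{\mathbf A}})]=\{x\in\Delta(\mathbf T_{\mathbf A}): \sum_{i\in\mathrm{Slk}(\mathbf A)}\sum_{s\in S_i\setminus A_i}x_s\le1\}$. The deep truncation (resp. fragment) of $\Delta(\mathbf S)$ along $\Delta(\mathbf A)$ is the product of $\operatorname{DTr}[\Delta(\mathbf T_{\mathbf A}),\Delta(\mathbf A|_{\mathbf T_{\mathbf A}})]$ (resp. $\operatorname{Fr}[\Delta(\mathbf T_{\mathbf A}),\Delta(\mathbf A|_{\mathbf T_{\mathbf A}})]$) with $\prod_{i\notin\mathrm{Slk}(\mathbf A)}\Delta(S_i)$. Fan. $\Psi$ is the complete fan in $\mathbb R^n$ with cones $\operatorname{Cone}(u_{\mathbf A_1},\dots,u_{\mathbf A_m})+\operatorname{Span}\{e_{S_1},\dots,e_{S_k}\}$, where $e_{S_i}=\sum_{s\in S_i}e_s$, over all (possibly empty) chains $\mathbf A_1\subsetneq\dots\subsetneq\mathbf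 A_m$ of valid tuples different from $\mathbf S$ (ordered by componentwise inclusion). Deformations. Support functions are $h(\mathsf Q,u)=\min_{x\in\mathsf Q}u\cdot x$, and normal fans are inner normal fans. $\operatorname{PL}(\Psi)$ is the vector space of functions on $\mathbb R^n$ linear on each cone of $\Psi$; the deformation cone $\operatorname{Def}(\Psi)$ consists of the support functions of polytopes whose normal fan coarsens $\Psi$ (each cone is a union of cones of $\Psi$). A polytopal basis is a collection of polytopes with normal fans coarsening $\Psi$ whose support functions form a basis of $\operatorname{PL}(\Psi)$. A deformation of $\mathsf P$ is a polytope whose normal fan coarsens that of $\mathsf P$; $\mathsf P$ is indecomposable if each of its deformations is a point or a translate of a positive dilate of $\mathsf P$. A polytopal basis is indecomposable if all its elements are. *)

(* Defs.v *)
From HB Require Import structures.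
From mathcomp Require Import all_boot all_order all_algebra.
From mathcomp Require Import boolp classical_sets functions cardinality reals.

Set Implicit Arguments.
Unset Strict Implicit.
Unset Printing Implicit Defensive.

Import Order.TTheory GRing.Theory Num.Theory.

Local Open Scope classical_set_scope.
Local Open Scope ring_scope.

Section LinearAlgebra.
Variables (R : realType) (V : lmodType R).
Implicit Types (W B : set V).

Definition lin_indep B :=
  forall (m : nat) (b : 'I_m -> V) (c : 'I_m -> R),
    injective b -> (forall i, B (b i)) -> \sum_i c i *: b i = 0 ->
    forall i, c i = 0.

Definition lin_combs B : set V :=
  [set v | exists (m : nat) (b : 'I_m -> V) (c : 'I_m -> R),
     (forall i, B (b i)) /\ v = \sum_i c i *: b i].

Definition is_basis W B := [/\ B `<=` W, lin_indep B & W `<=` lin_combs B].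

Definition conv (X : set V) : set V :=
  [set v | exists (m : nat) (p : 'I_m -> V) (a : 'I_m -> R),
     [/\ forall i, X (p i), forall i, 0 <= a i, \sum_i a i = 1
       & v = \sum_i a i *: p i]].

(* Polytopes are nonempty, so that support functions and (complete) normal
   fans make sense. *)
Definition is_polytope (P : set V) :=
  exists2 X : set V, finite_set X /\ X !=set0 & P = conv X.

Definition cone (s : seq V) : set V :=
  [set v | exists2 a : 'I_(size s) -> R,
     forall i, 0 <= a i & v = \sum_i a i *: s`_i].

(* A fan is represented by its set of cones. *)
Definition coarsens (F G : set (set V)) :=
  forall C, F C -> exists2 D, D `<=` G & C = \bigcup_(X in D) X.

(* [R^o] is [R] seen as a module over itself, so that the functions
   [V -> R^o] form an [lmodType]. *)
Definition PL (F : set (set V)) : set (V -> R^o) :=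
  [set f | forall C, F C ->
     exists l : {linear V -> R^o}, forall u, C u -> f u = l u].

End LinearAlgebra.

Section Polytopes.
Variables (R : realType) (n : nat).
Implicit Types (P Q F : set 'rV[R]_n) (u x : 'rV[R]_n).

Definition dot u x : R := \sum_i u 0 i * x 0 i.

(* On a polytope this infimum is a minimum. *)
Definition supp P u : R^o := inf [set dot u x | x in P].

Definition face P u : set 'rV[R]_n := [set x | P x /\ dot u x = supp P u].

Definition normal_cone P F : set 'rV[R]_n :=
  [set u | forall x, F x -> dot u x = supp P u].

Definition normal_fan P : set (set 'rV[R]_n) :=
  [set normal_cone P (face P u) | u in setT].

Definition deformation P Q :=
  is_polytope Q /\ coarsens (normal_fan Q) (normal_fan P).

Definition indecomposable P :=
  forall Q, deformation P Q ->
    (exists v, Q = [set v]) \/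
    (exists (c : R) (v : 'rV[R]_n), 0 < c /\ Q = [set c *: x + v | x in P]).

Definition polytopal_basis (Psi : set (set 'rV[R]_n))
    (C : set (set 'rV[R]_n)) :=
  (forall P, C P -> is_polytope P /\ coarsens (normal_fan P) Psi) /\
  is_basis (PL Psi) [set supp P | P in C].

Definition indecomposable_polytopal_basis (Psi : set (set 'rV[R]_n))
    (C : set (set 'rV[R]_n)) :=
  polytopal_basis Psi C /\ forall P, C P -> indecomposable P.

Definition e (s : 'I_n) : 'rV[R]_n := delta_mx 0 s.

Definition simplex (I : {set 'I_n}) : set 'rV[R]_n :=
  conv [set e s | s in [set s | s \in I]].

Definition restr (I : {set 'I_n}) x : 'rV[R]_n :=
  \row_s (if s \in I then x 0 s else 0).

End Polytopes.
Arguments e R {n}.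
Arguments simplex R {n}.

Section ProductsOfSimplices.
Variables (R : realType) (n k : nat).
Implicit Types (S A B : {ffun 'I_k -> {set 'I_n}}) (J : {set 'I_k}).

(* The product of the [simplex (S i)] for [i] in [J], for pairwise disjoint
   [S i]; a point of the product is embedded in R^n by zero outside the
   [S i], [i] in [J]. *)
Definition prod_simplex S J : set 'rV[R]_n :=
  [set x | (forall i, i \in J -> simplex R (S i) (restr (S i) x)) /\
           (forall s, (forall i, i \in J -> s \notin S i) -> x 0 s = 0)].

Definition valid S A := [forall i, (A i != finset.set0) && (A i \subset S i)].

Definition Slk S A : {set 'I_k} := [set i | A i != S i]%SET.

Definition slk S A := #|Slk S A|.

Definition uvec S A : 'rV[R]_n :=
  \sum_(s in (\bigcup_i S i)%SET :\: (\bigcup_i A i)%SET) e R s.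

(* Deep truncation and fragment of the product over [J] of the
   [simplex (S i)], along the product over [J] of the [simplex (A i)]. *)
Definition DTr S J A : set 'rV[R]_n :=
  [set x | prod_simplex S J x /\
           1 <= \sum_(i in J) \sum_(s in S i :\: A i) x 0 s].

Definition Fr S J A : set 'rV[R]_n :=
  [set x | prod_simplex S J x /\
           \sum_(i in J) \sum_(s in S i :\: A i) x 0 s <= 1].

Definition tproper A B := [forall i, A i \subset B i] && (A != B).

Definition lineality S : {vspace 'rV[R]_n} :=
  <<[seq (\sum_(s in S i) e R s)%R | i : 'I_k]>>%VS.

Definition barycentric_fan S : set (set 'rV[R]_n) :=
  [set C | exists c : seq {ffun 'I_k -> {set 'I_n}},
     [/\ {in c, forall A, valid S A /\ A != S}, sorted tproper c
       & C = [set v + w | v in cone [seq uvec S A | A <- c]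
                        & w in [set w | w \in lineality S]]]].

Definition simplicial_family S : set (set 'rV[R]_n) :=
  [set P | exists i (I : {set 'I_n}),
     [/\ I != finset.set0, I \subset S i & P = simplex R I]].

Definition DTr_family S : set (set 'rV[R]_n) :=
  [set DTr S (Slk S A) A | A in [set A | valid S A /\ (1 < slk S A)%N]].

Definition Fr_family S : set (set 'rV[R]_n) :=
  [set Fr S (Slk S A) A | A in [set A | valid S A /\ (1 < slk S A)%N]].

End ProductsOfSimplices.
Arguments barycentric_fan R {n k}.
Arguments simplicial_family R {n k}.
Arguments DTr_family R {n k}.
Arguments Fr_family R {n k}.

(* Main.v *)
From HB Require Import structures.
Require Import Defs.
From mathcomp Require Import all_boot all_order all_algebra.
From mathcomp Require Import boolp classical_sets functions cardinality reals.
From mathcomp Require Import ring lra.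

(** Write [B_i] for the complement of [A_i] in [S_i]. Deep truncations, fragments
    and simplices are treated at once, as polytopes [mixed J C D]: the convex
    hull of the products of simplices over the blocks in [J] in which one block
    ranges over [C] and the others over [D]. The deep truncation is the case
    [(B, S)] and the fragment the case [(S, A)] ([DTr_mixed], [Fr_mixed]): each
    point of the cut product is a mixture, over the choice of the special block,
    of points of these products. The vertices are sums of one [e_s] per block.

    Fan. On a cone of [Psi] given by a chain, the coordinates of a vector are, up
    to constants on blocks, ordered by the number of tuples of the chain that
    omit them. Hence one vertex minimizes the whole cone ([DTr_sim], [Fr_sim],
    [simplex_sim]). Since each vector lies in the relative interior of a cone
    ([fan_complete]), the normal fans coarsen [Psi] and the support functions are
    piecewise linear.

    Basis. A piecewise linear function is determined by its values on the rays
    [u_A] and on the [e_(S_i)] ([PL_det]). There are as many of these as elements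
    in each family, since a tuple with one slack block corresponds to a simplex
    on a proper subset of that block. So linear independence is enough
    ([square_basis]). The deep truncation along [A] has value 1 at [u_M] if [M]
    is contained in [A] and 0 otherwise, a triangular matrix. The fragment along
    [A] has at [u_M] the value one less than the number of slack blocks where [A]
    and [M] are disjoint (or 0 if there are none); an alternating sum over subsets
    of slack blocks isolates the coefficient of a minimal tuple
    ([Fr_independent]).

    Indecomposability. If [Q] is a deformation, each vertex [sum_j e_(f j)] of
    the polytope has a corresponding point of [Q]. Its coordinate [r] is the
    minimum of [x_r] on [Q] whenever [f] does not select [r], and its sum over
    each block does not depend on [f]. So it equals [c + sum_j m_j e_(f j)] with
    [c] and [m] independent of [f]. The face [sum_i sum_(s in B_i) x_s = 1] contains
    vertices that leave [A] in any prescribed single block, which makes all [m_j]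
    equal, so [Q] is a point or a translate of a dilate ([mixed_indecomposable]). *)

Set Implicit Arguments.
Unset Strict Implicit.
Unset Printing Implicit Defensive.
Import Order.TTheory GRing.Theory Num.Theory.

Local Open Scope classical_set_scope.

(** * Convex hulls *)

Section Convexity.
Local Open Scope ring_scope.
Variables (R : realType) (V : lmodType R).
Implicit Types X : set V.

Lemma sub_conv X : X `<=` conv X.
Proof.
move=> x Xx; exists 1%N, (fun=> x), (fun=> 1); split=> //.
  by rewrite big_ord1.
by rewrite big_ord1 scale1r.
Qed.

Lemma conv_fin (T : finType) X (p : T -> V) (a : T -> R) :
  (forall t, X (p t)) -> (forall t, 0 <= a t) -> \sum_t a t = 1 ->
  conv X (\sum_t a t *: p t).
Proof.
move=> Xp a0 a1.
exists #|T|, (fun i => p (enum_val i)), (fun i => a (enum_val i)); split=> //.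
  by rewrite -a1 (reindex _ (onW_bij _ (enum_val_bij T))).
by rewrite (reindex _ (onW_bij _ (enum_val_bij T))).
Qed.

(** Convex combinations of points of a convex hull stay in it; only the points
    of nonzero weight matter. *)
Lemma conv_sum (T : finType) X (p : T -> V) (a : T -> R) :
  (forall t, a t != 0 -> conv X (p t)) -> (forall t, 0 <= a t) ->
  \sum_t a t = 1 -> conv X (\sum_t a t *: p t).
Proof.
move=> Xp a0 a1.
have [t0 at0] : exists t, a t != 0.
  apply: contrapT => /forallNP h.
  suff : (1 : R) = 0 by move/eqP; rewrite oner_eq0.
  by rewrite -a1 big1 // => t _; apply/eqP; apply: contrapT => /negP/h.
pose p' t := if a t == 0 then p t0 else p t.
have Xp' t : conv X (p' t) by rewrite /p'; case: eqP => [_|/eqP]; apply: Xp.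
have -> : \sum_t a t *: p t = \sum_t a t *: p' t.
  apply: eq_bigr => t _; rewrite /p'.
  by case: eqP => [->|//]; rewrite !scale0r.
have ex_D t : exists D : {m : nat & (('I_m -> V) * ('I_m -> R))%type},
    [/\ forall i, X ((tagged D).1 i),
      forall i, 0 <= (tagged D).2 i, \sum_i (tagged D).2 i = 1
      & p' t = \sum_i (tagged D).2 i *: (tagged D).1 i].
  have [m [q [b qb]]] := Xp' t.
  by exists (Tagged (fun m => (('I_m -> V) * ('I_m -> R))%type) (q, b)).
have [D qb] := boolp.choice ex_D.
pose m t := tag (D t); pose q t : 'I_(m t) -> V := (tagged (D t)).1.
pose b t : 'I_(m t) -> R := (tagged (D t)).2.
have -> : \sum_t a t *: p' t =
    \sum_(u : {t : T & 'I_(m t)}) (a (tag u) * b (tag u) (tagged u))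
                                  *: q (tag u) (tagged u).
  rewrite -[RHS](sig_big_dep (J := fun t => 'I_(m t)) xpredT
    (fun=> xpredT) (fun t i => (a t * b t i) *: q t i)).
  apply: eq_bigr => t _; have [_ _ _ ->] := qb t.
  by rewrite scaler_sumr; apply: eq_bigr => i _; rewrite scalerA.
apply: conv_fin => [u|u|].
- by have [/(_ (tagged u))] := qb (tag u).
- by rewrite mulr_ge0 //; have [_ /(_ (tagged u))] := qb (tag u).
- rewrite -[LHS](sig_big_dep (J := fun t => 'I_(m t)) xpredT
    (fun=> xpredT) (fun t i => a t * b t i)) -a1.
  apply: eq_bigr => t _; have [_ _ b1 _] := qb t.
  by rewrite -mulr_sumr b1 mulr1.
Qed.

End Convexity.

(** * The pairing and support functions *)

Section Support.
Local Open Scope ring_scope.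
Variables (R : realType) (n : nat).
Implicit Types (P Q X : set 'rV[R]_n) (u v x y : 'rV[R]_n).

(** Pairing with a fixed point, as a linear functional. *)
Definition dotr x u : R^o := dot u x.

Lemma dotr_is_linear x : linear (dotr x).
Proof.
move=> a u v; rewrite /dotr /dot scaler_sumr -big_split /=.
by apply: eq_bigr => i _; rewrite !mxE mulrDl -mulrA.
Qed.
HB.instance Definition _ x :=
  GRing.isLinear.Build R 'rV[R]_n R^o *:%R (dotr x) (dotr_is_linear x).

Lemma dotC u x : dot u x = dot x u.
Proof. by apply: eq_bigr => i _; rewrite mulrC. Qed.

Lemma dotDl u v x : dot (u + v) x = dot u x + dot v x.
Proof. exact: (linearD (dotr x)). Qed.

Lemma dotZl a u x : dot (a *: u) x = a * dot u x.
Proof. exact: (linearZ_LR (dotr x)). Qed.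

Lemma dotNl u x : dot (- u) x = - dot u x.
Proof. exact: (linearN (dotr x)). Qed.

Lemma dot_suml I (r : seq I) (p : pred I) (F : I -> 'rV[R]_n) x :
  dot (\sum_(i <- r | p i) F i) x = \sum_(i <- r | p i) dot (F i) x.
Proof. exact: (linear_sum (dotr x)). Qed.

Lemma dotDr u x y : dot u (x + y) = dot u x + dot u y.
Proof. by rewrite dotC dotDl !(dotC u). Qed.

Lemma dotZr a u x : dot u (a *: x) = a * dot u x.
Proof. by rewrite dotC dotZl dotC. Qed.

Lemma dot_sumr I (r : seq I) (p : pred I) (F : I -> 'rV[R]_n) u :
  dot u (\sum_(i <- r | p i) F i) = \sum_(i <- r | p i) dot u (F i).
Proof. by rewrite dotC dot_suml; apply: eq_bigr => i _; rewrite dotC. Qed.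

Lemma dot_e s x : dot (e R s) x = x 0 s.
Proof.
rewrite /dot (bigD1 s) //= big1 ?addr0 => [|i /negbTE i_s].
  by rewrite mxE !eqxx mul1r.
by rewrite mxE i_s andbF mul0r.
Qed.

Lemma e_coord (s r : 'I_n) : e R s 0 r = (r == s)%:R.
Proof. by rewrite mxE. Qed.

Lemma scale_e_coord a (s r : 'I_n) : (a *: e R s) 0 r = a * (r == s)%:R.
Proof. by rewrite mxE e_coord. Qed.

Lemma row_sum_e x : x = \sum_s x 0 s *: e R s.
Proof. exact: row_sum_delta. Qed.

Lemma conv_ge X u b : (forall x, X x -> b <= dot u x) ->
  forall x, conv X x -> b <= dot u x.
Proof.
move=> Xb _ [m [p [a [Xp a0 a1 ->]]]].
rewrite dot_sumr -[b]mul1r -a1 mulr_suml; apply: ler_sum => i _.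
by rewrite dotZr ler_wpM2l // Xb.
Qed.

Lemma suppE P u x : P x -> (forall y, P y -> dot u x <= dot u y) ->
  supp P u = dot u x.
Proof.
move=> Px xmin; apply/eqP; rewrite eq_le; apply/andP; split.
  apply: ge_inf; last by exists x.
  by exists (dot u x) => _ [y Py <-]; apply: xmin.
by apply: lb_le_inf; [exists (dot u x); exists x | move=> _ [y Py <-]; apply: xmin].
Qed.

Lemma conv_min X u : finite_set X -> X !=set0 ->
  exists2 x, X x & forall y, conv X y -> dot u x <= dot u y.
Proof.
case/finite_seqP=> s Xs [x0 Xx0].
have x0s : x0 \in s by move: Xx0; rewrite Xs.
have [x xs xmin] : exists2 x, x \in s & forall y, y \in s -> dot u x <= dot u y.
  have [t _ tmin] := @arg_minP _ R (seq_sub s) (SeqSub x0s) xpredT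
    (fun t => dot u (ssval t)) isT.
  exists (ssval t); first exact: ssvalP.
  by move=> y ys; exact: (tmin (SeqSub ys)).
exists x; first by rewrite Xs.
by apply: conv_ge => y; rewrite Xs => /xmin.
Qed.

Lemma polytope_min P u : is_polytope P ->
  exists2 x, P x & forall y, P y -> dot u x <= dot u y.
Proof.
case=> X [finX X0] ->; have [x Xx xmin] := conv_min u finX X0.
by exists x => //; apply: sub_conv.
Qed.

Lemma supp_attained P u : is_polytope P -> exists2 x, P x & supp P u = dot u x.
Proof.
by move=> /(polytope_min u)[x Px xmin]; exists x => //; apply: suppE.
Qed.

Lemma supp_le P u y : is_polytope P -> P y -> supp P u <= dot u y.
Proof.
move=> /(polytope_min u)[x Px xmin] Py.
by rewrite (suppE Px xmin) xmin.
Qed.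

Lemma le_supp P u b : is_polytope P -> (forall x, P x -> b <= dot u x) ->
  b <= supp P u.
Proof. by move=> /(supp_attained u)[x Px ->]; apply. Qed.

Lemma faceP P u x : P x -> (forall y, P y -> dot u x <= dot u y) -> face P u x.
Proof. by move=> Px xmin; split=> //; rewrite (suppE Px xmin). Qed.

End Support.

(** * Blocks and the barycentric fan *)

Section Blocks.
Local Open Scope ring_scope.
Variables (R : realType) (n k : nat) (S : {ffun 'I_k -> {set 'I_n}}).
Hypotheses (injS : injective S)
  (partS : finset.partition (S @: 'I_k) [set: 'I_n]%SET).
Implicit Types (A B M : {ffun 'I_k -> {set 'I_n}}) (s t r : 'I_n) (i j : 'I_k).
Implicit Types (c : seq {ffun 'I_k -> {set 'I_n}}) (u v w x y : 'rV[R]_n).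

Lemma block_exists s : exists i, s \in S i.
Proof.
have : s \in finset.cover (S @: 'I_k) by rewrite (finset.cover_partition partS) inE.
by case/finset.bigcupP => _ /imsetP[i _ ->] si; exists i.
Qed.

(** The index of the block that contains [s]. *)
Definition bl s : 'I_k := xchoose (block_exists s).

Lemma mem_bl s : s \in S (bl s).
Proof. exact: (xchooseP (block_exists s)). Qed.

Lemma in_block s i : (s \in S i) = (bl s == i).
Proof.
apply/idP/eqP => [si|<-]; last exact: mem_bl.
apply: injS; apply/eqP; apply/negPn/negP => neq.
have /finset.trivIsetP/(_ (S (bl s)) (S i)) := finset.partition_trivIset partS.
rewrite !imset_f // => /(_ isT isT neq) /pred0P /(_ s) /=.
by rewrite mem_bl si.
Qed.

Lemma block_neq0 i : exists s, s \in S i.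
Proof.
apply/finset.set0Pn; apply/negP => /eqP Si0.
have : finset.set0 \in S @: 'I_k by rewrite -Si0 imset_f.
by case/and3P: partS => _ _ /negbTE ->.
Qed.

(** The vector with constant value [om i] on the block [i]. *)
Definition blockrow (om : 'I_k -> R) : 'rV[R]_n := \row_r om (bl r).

(** The vector [e_(S_i)] of the block [i]. *)
Definition eblock i : 'rV[R]_n := \sum_(s in S i) e R s.

Lemma coord_sum_e (D : {pred 'I_n}) r :
  (\sum_(s in D) e R s) 0 r = (r \in D)%:R.
Proof.
rewrite summxE; case: (boolP (r \in D)) => rD.
  rewrite (bigD1 r) //= e_coord eqxx big1 ?addr0 // => s /andP[_ /negbTE sr].
  by rewrite e_coord eq_sym sr.
rewrite big1 // => s sD; rewrite e_coord; case: eqP => // rs.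
by rewrite rs sD in rD.
Qed.

Lemma dot_sum_e (D : {pred 'I_n}) x :
  dot (\sum_(s in D) e R s) x = \sum_(s in D) x 0 s.
Proof. by rewrite dot_suml; apply: eq_bigr => s _; rewrite dot_e. Qed.

Lemma eblockE i r : eblock i 0 r = (bl r == i)%:R.
Proof. by rewrite coord_sum_e in_block. Qed.

Lemma blockrowE om : blockrow om = \sum_i om i *: eblock i.
Proof.
apply/rowP => r; rewrite !mxE summxE (bigD1 (bl r)) //= big1 => [|i ri].
  by rewrite mxE eblockE eqxx mulr1 addr0.
by rewrite mxE eblockE eq_sym (negbTE ri) mulr0.
Qed.

Lemma blockrow_delta i : blockrow (fun j => (j == i)%:R) = eblock i.
Proof. by apply/rowP => r; rewrite eblockE mxE. Qed.

Lemma linealityP w : reflect (exists om, w = blockrow om) (w \in lineality R S).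
Proof.
rewrite /lineality span_def big_image /=.
apply: (iffP memv_sumP) => [[vs vsE ->]|[om ->]].
  have /boolp.choice[om omE] : forall i, exists a : R, vs i = a *: eblock i.
    by move=> i; apply/vlineP/vsE.
  by exists om; rewrite blockrowE; apply: eq_bigr.
exists (fun i => om i *: eblock i) => [i _|]; last by rewrite blockrowE.
by apply: memvZ; apply: memv_line.
Qed.

Lemma valid_sub A i s : valid S A -> s \in A i -> bl s = i.
Proof.
by move=> /forallP/(_ i)/andP[_ /fintype.subsetP AS] /AS; rewrite in_block => /eqP.
Qed.

Lemma valid_neq0 A i : valid S A -> exists s, s \in A i.
Proof. by move=> /forallP/(_ i)/andP[/finset.set0Pn]. Qed.

Lemma uvecE A r : valid S A -> uvec R S A 0 r = (r \notin A (bl r))%:R.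
Proof.
move=> vA; rewrite coord_sum_e !inE; congr (nat_of_bool _)%:R.
have -> : r \in (\bigcup_i S i)%SET.
  by apply/finset.bigcupP; exists (bl r); rewrite ?mem_bl.
rewrite andbT; congr negb; apply/finset.bigcupP/idP => [[i _ rA]|rA]; last first.
  by exists (bl r).
by rewrite (valid_sub vA rA).
Qed.

(** Chains of valid tuples different from [S]; they index the cones of the
    barycentric fan. *)
Definition chain c :=
  {in c, forall A, valid S A /\ A != S} /\ sorted (@tproper n k) c.

(** The cone of the fan that belongs to the chain [c]. *)
Definition chain_cone c : set 'rV[R]_n :=
  [set v + w | v in cone [seq uvec R S A | A <- c]
             & w in [set w | w \in lineality R S]].

Lemma tproper_irr : irreflexive (@tproper n k).
Proof. by move=> A; rewrite /tproper eqxx andbF. Qed.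

Lemma tproper_sub A B i : tproper A B -> A i \subset B i.
Proof. by move=> /andP[/forallP]. Qed.

Lemma tproper_trans : transitive (@tproper n k).
Proof.
move=> B A C AB BC; rewrite /tproper; apply/andP; split.
  apply/forallP => i.
  exact: fintype.subset_trans (tproper_sub i AB) (tproper_sub i BC).
apply/eqP => eAC; rewrite -eAC in BC.
have AeB : A = B.
  apply/ffunP => i; apply/eqP.
  by rewrite finset.eqEsubset (tproper_sub i AB) (tproper_sub i BC).
by rewrite AeB tproper_irr in AB.
Qed.

Lemma chain_uniq c : chain c -> uniq c.
Proof. by case=> _; apply: sorted_uniq; [apply: tproper_trans|apply: tproper_irr]. Qed.

Lemma chain_cons A c : chain (A :: c) ->
  [/\ valid S A, A != S, chain c & forall B, B \in c -> tproper A B].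
Proof.
case=> vc /= Ac; have [vA nA] := vc A (mem_head _ _); split=> //.
  split; last exact: path_sorted Ac.
  by move=> B Bc; apply: vc; rewrite inE Bc orbT.
by move=> B Bc; apply: (seq.allP (order_path_min tproper_trans Ac)).
Qed.

(** A point of a cone of the fan is a nonnegative combination of the rays of
    the chain, up to a vector constant on blocks. *)
Lemma chain_coneP c u : chain c -> (chain_cone c u <->
  exists (a : {ffun 'I_k -> {set 'I_n}} -> R) om, (forall A, 0 <= a A) /\
    u = \sum_(A <- c) a A *: uvec R S A + blockrow om).
Proof.
move=> hc; split=> [[v [a a0 ->] [w /linealityP[om ->] <-]]|[a [om [a0 ->]]]].
  pose b A : R := oapp a 0 (insub (index A c)).
  exists b, om; split=> [A|]; first by rewrite /b; case: insub.
  congr (_ + _); rewrite (big_nth S) big_mkord.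
  have Esz : size c = size [seq uvec R S A | A <- c] by rewrite size_map.
  rewrite (reindex (cast_ord (esym Esz))) /=; last first.
    by apply: onW_bij; exists (cast_ord Esz) => i;
       [rewrite cast_ordKV | rewrite cast_ordK].
  apply: eq_bigr => i _.
  have ic : (i < size c)%N by rewrite Esz.
  rewrite (nth_map S) // /b index_uniq // ?(chain_uniq hc) //.
  by congr (_ *: _); rewrite insubT //= => i'; congr a; apply: val_inj.
exists (\sum_(A <- c) a A *: uvec R S A).
  exists (fun i : 'I_(size [seq uvec R S A | A <- c]) => a (nth S c i)) => //.
  rewrite (big_nth S) big_mkord size_map; apply: eq_bigr => i _.
  by rewrite (nth_map S).
by exists (blockrow om) => //; apply/linealityP; exists om.
Qed.

Lemma chain_cone_ray c A : chain c -> A \in c -> chain_cone c (uvec R S A).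
Proof.
move=> hc Ac; apply/(chain_coneP _ hc).
exists (fun B => (B == A)%:R), (fun=> 0); split=> [B|]; first exact: ler0n.
rewrite (bigD1_seq A) ?(chain_uniq hc) //= eqxx scale1r big1 => [|B /negbTE->].
  by apply/rowP => r; rewrite !mxE !addr0.
by rewrite scale0r.
Qed.

Lemma chain_cone_blockrow c om : chain c -> chain_cone c (blockrow om).
Proof.
move=> hc; apply/(chain_coneP _ hc); exists (fun=> 0), om; split=> //.
by rewrite big1 ?add0r // => A _; rewrite scale0r.
Qed.

(** The number of tuples of the chain that omit [s]: on a cone of the fan the
    coordinates inside a block are ordered by level. *)
Definition lvl c s : nat := count (fun A => s \notin A (bl s)) c.

Lemma chain_total c A B : chain c -> A \in c -> B \in c ->
  [\/ A = B, tproper A B | tproper B A].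
Proof.
elim: c A B => // C c IH A B /chain_cons[_ _ hc lt_C].
rewrite !inE => /orP[/eqP->|Ac] /orP[/eqP->|Bc].
- by constructor 1.
- by constructor 2; apply: lt_C.
- by constructor 3; apply: lt_C.
- exact: IH.
Qed.

(** The tuples of a chain that omit [s] form an initial segment of it, so the
    level of [s] determines which ones they are. *)
Lemma lvl_mono c s t : chain c -> (lvl c s <= lvl c t)%N ->
  forall A, A \in c -> s \notin A (bl s) -> t \notin A (bl t).
Proof.
move=> hc le_st A Ac sA; apply/negP => tA; move: le_st; apply/negP.
rewrite -ltnNge /lvl -!size_filter.
apply: (@uniq_leq_size _
  (A :: [seq B : {ffun 'I_k -> {set 'I_n}} <- c | t \notin B (bl t)])).
  by rewrite /= mem_filter tA /= filter_uniq // chain_uniq.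
move=> B; rewrite inE mem_filter => /orP[/eqP->|/andP[tB Bc]].
  by rewrite mem_filter sA.
rewrite mem_filter Bc andbT.
have [eBA|lt_BA|lt_AB] := chain_total hc Bc Ac.
- by rewrite eBA tA in tB.
- by apply: contra sA; apply: (fintype.subsetP (tproper_sub _ lt_BA)).
- by case/negP: tB; apply: (fintype.subsetP (tproper_sub _ lt_AB)).
Qed.

(** The elements of the least tuple of the chain have level zero; in the empty
    chain every element does. *)
Lemma lvl0 c i : chain c -> exists2 s, s \in S i & lvl c s = 0%N.
Proof.
case: c => [|A c] hc; first by have [s sS] := block_neq0 i; exists s.
have [vA _ _ lt_A] := chain_cons hc.
have [s sA] := valid_neq0 i vA; have si := valid_sub vA sA.
exists s; first by rewrite in_block si.
apply/eqP; rewrite eqn0Ngt -has_count; apply/hasPn => B.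
rewrite inE si negbK => /orP[/eqP->//|/lt_A AB].
exact: (fintype.subsetP (tproper_sub _ AB)).
Qed.

(** On a cone of the fan, the coordinates are, up to a constant on each block,
    a nondecreasing function of the level that vanishes at level zero. *)
Lemma chain_cone_lvl c u : chain c -> chain_cone c u ->
  exists (p : 'I_n -> R) om, [/\ forall s, u 0 s = p s + om (bl s),
    forall s t, (lvl c s <= lvl c t)%N -> p s <= p t
    & forall s, lvl c s = 0%N -> p s = 0].
Proof.
move=> hc /(chain_coneP u hc)[a [om [a0 ->]]].
pose p s := \sum_(A <- c) a A * (s \notin A (bl s))%:R.
exists p, om; split=> [s|s t le_st|s s0].
- rewrite !mxE; congr (_ + _); rewrite summxE.
  by apply: eq_big_seq => A Ac; rewrite mxE uvecE //; have [] := hc.1 A Ac.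
- rewrite /p !(big_seq_cond xpredT) /=; apply: ler_sum => A /andP[Ac _].
  apply: ler_wpM2l => //; rewrite ler_nat.
  by have := lvl_mono hc le_st Ac; case: (s \notin _) => // ->.
- rewrite /p big1_seq // => A /andP[_ Ac].
  move/eqP: s0; rewrite eqn0Ngt -has_count => /hasPn/(_ A Ac)/negbTE ->.
  by rewrite mulr0.
Qed.

(** The tuple of zero sets of [v] on the blocks. *)
Definition zeros (v : 'I_n -> R) : {ffun 'I_k -> {set 'I_n}} :=
  [ffun i => [set s in S i | v s == 0]%SET].

Lemma in_zeros (v : 'I_n -> R) s : (s \in zeros v (bl s)) = (v s == 0).
Proof. by rewrite ffunE !inE mem_bl. Qed.

Lemma zerosT (v : 'I_n -> R) : zeros v = S -> forall s, v s = 0.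
Proof. by move=> e s; apply/eqP; rewrite -in_zeros e mem_bl. Qed.

(** A nonnegative [v] with a zero in each block is a positive combination of the
    indicators of the complements of a chain that starts at [zeros v]: subtract
    the least nonzero value of [v] from all its nonzero values, and repeat. The
    default value [S] of [head] covers the case [v = 0]. *)
Lemma chain_decomp (v : 'I_n -> R) : (forall s, 0 <= v s) ->
  (forall i, exists2 s, s \in S i & v s = 0) ->
  exists c a, [/\ chain c, head S c = zeros v, forall A, 0 <= a A :> R,
    {in c, forall A, 0 < a A}
    & forall s, v s = \sum_(A <- c) a A * (s \notin A (bl s))%:R].
Proof.
move: {2}(#|_|) (leqnn #|[set s | v s != 0]%SET|) => m.
elim: m v => [|m IH] v hm v0 vZ.
  have vE s : v s = 0.
    apply/eqP; move: hm; rewrite leqn0 cards_eq0 => /eqP/setP/(_ s).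
    by rewrite !inE => /negbFE.
  exists [::], (fun=> 0); split=> //= [|s]; last by rewrite big_nil.
  by apply/ffunP => i; rewrite ffunE; apply/setP => s; rewrite !inE vE eqxx andbT.
have [e|nS] := eqVneq (zeros v) S.
  exists [::], (fun=> 0); split=> //= s; rewrite big_nil; exact: zerosT.
have [s0 vs0] : exists s0, v s0 != 0.
  apply: contrapT => /forallNP h; case/eqP: nS; apply/ffunP => i.
  rewrite ffunE; apply/setP => s; rewrite !inE.
  by move: (h s) => /negP/negbNE ->; rewrite andbT.
have [s1 /= vs1 s1min] := @arg_minP _ R _ s0 (fun s => v s != 0) v vs0.
pose b := v s1; have b0 : 0 < b by rewrite lt_def vs1 v0.
pose v' s := v s - b * (v s != 0)%:R.
have v'0 s : 0 <= v' s.
  rewrite /v'; case: (boolP (v s == 0)) => [/eqP->|vs].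
    by rewrite mulr0 subr0.
  by rewrite mulr1 subr_ge0 s1min.
have v'Z s : v s = 0 -> v' s = 0 by rewrite /v' => ->; rewrite eqxx mulr0 subr0.
have v's1 : v' s1 = 0 by rewrite /v' vs1 mulr1 subrr.
have [||c [a [hc hd a0 apos v'E]]] := IH v' _ v'0.
- rewrite -ltnS; apply: leq_trans hm; apply: proper_card.
  apply/fintype.properP; split.
    apply/fintype.subsetP => s; rewrite !inE; apply: contra => /eqP vs.
    by rewrite v'Z.
  by exists s1; rewrite !inE ?v's1 ?eqxx.
- by move=> i; have [s sS vs] := vZ i; exists s => //; apply: v'Z.
have vz : valid S (zeros v).
  apply/forallP => i; apply/andP; split.
    have [s sS vs] := vZ i; apply/finset.set0Pn; exists s.
    by rewrite ffunE !inE sS vs eqxx.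
  by apply/fintype.subsetP => s; rewrite ffunE !inE => /andP[].
have lt_zz : tproper (zeros v) (zeros v').
  apply/andP; split.
    apply/forallP => i; apply/fintype.subsetP => s; rewrite !ffunE !inE.
    by move=> /andP[-> /eqP/v'Z ->]; rewrite eqxx.
  apply/eqP => e; have := in_zeros v s1; rewrite e in_zeros v's1 eqxx.
  by rewrite (negbTE vs1).
have hc' : chain (zeros v :: c).
  split=> [A|/=]; first by rewrite inE => /orP[/eqP->//|/(hc.1 A)].
  by case: c hc hd {apos v'E} => //= B c [_ srt] eB; rewrite eB lt_zz -eB.
have zc : zeros v \notin c by have /= /andP[] := chain_uniq hc'.
exists (zeros v :: c), (fun A => if A == zeros v then b else a A); split=> //.
- by move=> A; case: eqP => // _; apply: ltW.
- by move=> A; rewrite inE; case: eqP => //= _ /apos.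
move=> s; rewrite big_cons eqxx in_zeros.
under eq_big_seq => A Ac.
  have -> : (A == zeros v) = false by apply: contraNF zc => /eqP <-.
  over.
by rewrite -v'E /v' addrC subrK.
Qed.

(** The fan is complete, and every vector lies in the relative interior of one
    of its cones. *)
Lemma fan_complete u : exists c a om, [/\ chain c, forall A, 0 <= a A :> R,
  {in c, forall A, 0 < a A}
  & u = \sum_(A <- c) a A *: uvec R S A + blockrow om].
Proof.
have /boolp.choice[m mP] : forall i, exists s, s \in S i /\
    forall t, t \in S i -> u 0 s <= u 0 t.
  move=> i; have [s0 s0S] := block_neq0 i.
  have [s sS smin] := @arg_minP _ R _ s0 (mem (S i)) (u 0) s0S.
  by exists s.
pose v s := u 0 s - u 0 (m (bl s)).
have [s|i|c [a [hc _ a0 apos vE]]] := @chain_decomp v.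
- by rewrite subr_ge0; apply: (mP _).2; apply: mem_bl.
- have [mS _] := mP i; exists (m i) => //.
  by rewrite /v; move: mS; rewrite in_block => /eqP ->; rewrite subrr.
exists c, a, (fun i => u 0 (m i)); split=> //.
apply/rowP => s; rewrite !mxE summxE; move/eqP: (vE s).
rewrite subr_eq => /eqP ->; congr (_ + _).
by apply: eq_big_seq => A Ac; rewrite mxE uvecE //; have [] := hc.1 A Ac.
Qed.

(** Each cone of the fan has a single point of [P] that minimizes all its
    elements over [P]. This is how it is shown that the normal fan of [P]
    coarsens the barycentric fan. *)
Definition simultaneous_min (P : set 'rV[R]_n) :=
  forall c, chain c -> exists2 y, P y &
    forall u, chain_cone c u -> forall x, P x -> dot u y <= dot u x.

Lemma fan_chain_cone c : chain c -> barycentric_fan R S (chain_cone c).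
Proof. by case=> vc sc; exists c. Qed.

Lemma sim_coarsens P : simultaneous_min P ->
  coarsens (normal_fan P) (barycentric_fan R S).
Proof.
move=> simP _ [u0 _ <-].
exists [set C | barycentric_fan R S C /\ C `<=` normal_cone P (face P u0)].
  by move=> C [].
apply/seteqP; split=> [u Nu|u [C [_ +] Cu]]; last exact.
(* The cone is chosen with [u] in its relative interior: all [a A] are positive,
   so a minimizer of [u] minimizes every ray of the cone. *)
have [c [a [om [hc a0 apos uE]]]] := fan_complete u.
have uc : chain_cone c u by apply/(chain_coneP u hc); exists a, om.
exists (chain_cone c) => //; split; first exact: fan_chain_cone.
have [y Py ymin] := simP c hc.
have suppP v : chain_cone c v -> supp P v = dot v y.
  by move=> vc; apply: suppE => // x; apply: ymin.
move=> u' u'c x Fx; have Px := Fx.1; rewrite suppP //.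
have dotom om' : dot (blockrow om') x = dot (blockrow om') y.
  apply/eqP; rewrite eq_le (ymin _ (chain_cone_blockrow _ hc)) // andbT.
  have -> : blockrow om' = - blockrow (fun i => - om' i).
    by apply/rowP => r; rewrite !mxE opprK.
  by rewrite !dotNl lerN2 (ymin _ (chain_cone_blockrow _ hc)).
have dotA A : A \in c -> dot (uvec R S A) x = dot (uvec R S A) y.
  have := Nu x Fx; rewrite suppP // uE !dotDl !dotom => /addIr.
  move=> /eqP; rewrite -subr_eq0 (dot_suml _ _ _ x) (dot_suml _ _ _ y) -sumrB.
  move=> h Ac; move: h; rewrite big_seq_cond psumr_eq0 => [/allP/(_ A Ac)|B /andP[Bc _]].
    rewrite Ac /= !dotZl -mulrBr mulf_eq0 gt_eqF ?apos //= subr_eq0.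
    by move/eqP.
  by rewrite !dotZl -mulrBr mulr_ge0 // subr_ge0 (ymin _ (chain_cone_ray hc Bc)).
have [a' [om' [_ ->]]] := (chain_coneP u' hc).1 u'c.
rewrite !dotDl dotom !dot_suml; congr (_ + _).
by apply: eq_big_seq => A /dotA dA; rewrite !dotZl dA.
Qed.

Lemma sim_PL P : simultaneous_min P -> PL (barycentric_fan R S) (supp P).
Proof.
move=> simP _ [c [vc sc ->]]; have hc : chain c by [].
have [y Py ymin] := simP c hc; exists (dotr y) => u uc.
by apply: suppE => // x; apply: ymin.
Qed.

(** A piecewise linear function is determined by its values on the rays and on
    the lineality space. *)
Lemma PL_det (f : 'rV[R]_n -> R^o) : PL (barycentric_fan R S) f ->
  (forall A, valid S A -> A != S -> f (uvec R S A) = 0) ->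
  (forall i, f (eblock i) = 0) -> f = 0.
Proof.
move=> PLf fA fi; apply/funext => u.
have [c [a [om [hc a0 _ uE]]]] := fan_complete u.
have [l lE] := PLf _ (fan_chain_cone hc).
have -> : f u = l u by apply: lE; apply/(chain_coneP u hc); exists a, om.
rewrite uE blockrowE linearD !linear_sum big1_seq => [|A /andP[_ Ac]].
  rewrite add0r big1 // => i _; rewrite linearZ_LR -lE ?fi ?scaler0 //.
  by rewrite -blockrow_delta; apply: chain_cone_blockrow.
have [vA nA] := hc.1 A Ac; rewrite linearZ_LR -lE ?fA ?scaler0 //.
exact: chain_cone_ray.
Qed.

End Blocks.

(** * Bases from as many evaluation points as functions *)

Section SquareBasis.
Local Open Scope ring_scope.
Variables (R : realType) (n : nat) (T : finType).
Implicit Types (W : set ('rV[R]_n -> R^o)) (phi : T -> 'rV[R]_n -> R^o).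

Lemma lin_combE (c : T -> R) phi u :
  (\sum_t c t *: phi t) u = \sum_t c t * phi t u.
Proof. by rewrite fct_sumE; apply: eq_bigr. Qed.

(** As many functions as evaluation points: independence implies that the
    square matrix of values is invertible, hence also spanning. *)
Lemma square_basis W phi (pt : T -> 'rV[R]_n) :
  (forall c : T -> R, W (\sum_t c t *: phi t)) ->
  (forall f, W f -> forall c : T -> R, W (f - \sum_t c t *: phi t)) ->
  (forall f, W f -> (forall t, f (pt t) = 0) -> f = 0) ->
  (forall c : T -> R, \sum_t c t *: phi t = 0 -> forall t, c t = 0) ->
  (forall t, W (phi t)) ->
  is_basis W [set phi t | t in setT].
Proof.
move=> Wsum Wsub det indep Wphi; split.
- by move=> _ [t _ <-].
- move=> m b c injb Bb bc0 i.
  have /boolp.choice[tau tauE] : forall i, exists t, phi t = b i.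
    by move=> j; have [t _ <-] := Bb j; exists t.
  have tau_inj : injective tau.
    by move=> j l e; apply: injb; rewrite -!tauE e.
  pose d t := \sum_(j | tau j == t) c j.
  have d0 : \sum_t d t *: phi t = 0.
    rewrite -[RHS]bc0 [RHS](partition_big tau xpredT) //=; apply: eq_bigr => t _.
    rewrite /d scaler_suml; apply: eq_bigr => j /eqP <-.
    by rewrite tauE.
  have := indep d d0 (tau i); rewrite /d (bigD1 i) //= big1 ?addr0 //.
  by move=> j /andP[/eqP/tau_inj ->]; rewrite eqxx.
pose M : 'M[R]_#|T| := \matrix_(i, j) phi (enum_val i) (pt (enum_val j)).
have Mfree : row_free M.
  rewrite -kermx_eq0; apply/eqP/row_matrixP => i; rewrite row0.
  pose v := row i (kermx M); pose c t := v 0 (enum_rank t).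
  have vM : v *m M = 0 by rewrite /v -row_mul mulmx_ker row0.
  have c0 : \sum_t c t *: phi t = 0.
    apply: det => // t; rewrite lin_combE.
    move/rowP: vM => /(_ (enum_rank t)); rewrite !mxE => vMt; rewrite -[RHS]vMt.
    rewrite (reindex _ (onW_bij _ (enum_val_bij T))) /=.
    by apply: eq_bigr => j _; rewrite /c enum_valK [M _ _]mxE enum_rankK.
  apply/rowP => j; have := indep c c0 (enum_val j).
  by rewrite /c enum_valK mxE => ->; rewrite mxE.
move=> f Wf; pose y : 'rV[R]_#|T| := \row_j f (pt (enum_val j)).
pose v := y *m invmx M; pose c t := v 0 (enum_rank t).
have fE : f = \sum_t c t *: phi t.
  apply/eqP; rewrite -subr_eq0; apply/eqP; apply: det => [|t]; first exact: Wsub.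
  have vM : v *m M = y by rewrite mulmxKV // -row_free_unit.
  have -> : (f - \sum_t0 c t0 *: phi t0) (pt t) =
    f (pt t) - (\sum_t0 c t0 *: phi t0) (pt t) by [].
  rewrite lin_combE; move/rowP: vM => /(_ (enum_rank t)).
  rewrite !mxE enum_rankK => <-; apply/eqP; rewrite subr_eq0; apply/eqP.
  rewrite [RHS](reindex _ (onW_bij _ (enum_val_bij T))) /=.
  by apply: eq_bigr => j _; rewrite /c enum_valK [M _ _]mxE enum_rankK.
exists #|T|, (fun i => phi (enum_val i)), (fun i => c (enum_val i)).
split=> [i|]; first by exists (enum_val i).
by rewrite fE (reindex _ (onW_bij _ (enum_val_bij T))).
Qed.

Lemma linear_dot (l : {linear 'rV[R]_n -> R^o}) u :
  l u = dot u (\row_s (l (e R s) : R)).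
Proof.
rewrite {1}(row_sum_e u) linear_sum; apply: eq_bigr => s _.
by rewrite linearZ_LR mxE.
Qed.

Lemma PL_sum (F : set (set 'rV[R]_n)) phi (c : T -> R) :
  (forall t, PL F (phi t)) -> PL F (\sum_t c t *: phi t).
Proof.
move=> PLphi C FC.
have [l lE] := boolp.choice (fun t => PLphi t C FC).
pose y t : 'rV[R]_n := \row_s (l t (e R s) : R).
exists (dotr (\sum_t c t *: y t)) => u Cu.
rewrite lin_combE; change (\sum_t c t * phi t u = dot u (\sum_t c t *: y t)).
rewrite dot_sumr; apply: eq_bigr => t _.
by rewrite dotZr lE // linear_dot.
Qed.

Lemma PL_sub (F : set (set 'rV[R]_n)) (f g : 'rV[R]_n -> R^o) :
  PL F f -> PL F g -> PL F (f - g).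
Proof.
move=> PLf PLg C FC; have [l lE] := PLf C FC; have [m mE] := PLg C FC.
exists (dotr (\row_s (l (e R s) : R) - \row_s (m (e R s) : R))) => u Cu.
have -> : (f - g) u = f u - g u by [].
rewrite lE // mE // linear_dot [X in _ - X]linear_dot.
by rewrite -[X in _ + X]mulN1r -dotZr scaleN1r -dotDr.
Qed.

End SquareBasis.

(** * Probability vectors *)

Section Prob.
Local Open Scope ring_scope.
Variables (R : realType) (n : nat).
Implicit Types (E B : {set 'I_n}) (q x : 'I_n -> R).

(** Probability vectors supported on [E]. *)
Definition prob E q :=
  [/\ forall s, 0 <= q s, forall s, s \notin E -> q s = 0 & \sum_s q s = 1].

Lemma prob_sum E q : prob E q -> \sum_(s in E) q s = 1.
Proof.
case=> _ qE <-; rewrite big_mkcond /=; apply: eq_bigr => s _.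
by case: ifPn => // /qE ->.
Qed.

Lemma prob_delta E r : r \in E -> prob E (fun s => (s == r)%:R).
Proof.
move=> rE; split=> [s|s|]; first exact: ler0n.
  by apply: contraNeq; rewrite pnatr_eq0 eqb0 negbK => /eqP ->.
by rewrite (bigD1 r) //= eqxx big1 ?addr0 // => s /negbTE ->.
Qed.

(** A probability vector giving mass at least [w] to [B] is a mixture with
    weight [w] on a probability vector supported on [B]. *)
Lemma prob_split E B x (w : R) : prob E x -> B \subset E -> B != finset.set0 ->
  0 <= w -> w <= \sum_(s in B) x s ->
  exists p z, [/\ prob B p, prob E z & forall s, x s = w * p s + (1 - w) * z s].
Proof.
move=> xE BE /finset.set0Pn[b bB] w0 wB.
have [x0 xnE x1] := xE; have xE1 := prob_sum xE.
have [w_0|wn0] := eqVneq w 0.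
  exists (fun s => (s == b)%:R), x; split=> //; first exact: prob_delta.
  by move=> s; rewrite w_0 mul0r add0r subr0 mul1r.
have w_gt0 : 0 < w by rewrite lt_def wn0.
set m := \sum_(s in B) x s in wB; have m0 : 0 < m by apply: lt_le_trans wB.
have m1 : m <= 1.
  rewrite -xE1 [leRHS](big_setID B) /= (finset.setIidPr BE) lerDl.
  by apply: sumr_ge0.
pose p s := if s \in B then x s / m else 0.
have pB : prob B p.
  split=> [s|s|]; rewrite /p.
  - by case: ifP => // _; rewrite divr_ge0 // ltW.
  - by move=> /negbTE ->.
  - by rewrite -big_mkcond /= -mulr_suml divff ?gt_eqF.
have pE : prob E p.
  case: pB => p0 pnB p1; split=> // s sE; apply: pnB.
  by apply: contra sE; apply: (fintype.subsetP BE).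
have [w1|wn1] := eqVneq w 1.
  exists p, p; split=> // s; rewrite w1 mul1r subrr mul0r addr0 /p.
  have m_1 : m = 1 by apply/eqP; rewrite eq_le m1 -w1.
  rewrite m_1 divr1; case: ifPn => // sB; case: (boolP (s \in E)) => [sE|/xnE //].
  have : \sum_(s in E :\: B) x s = 0.
    move: xE1; rewrite (big_setID B) /= (finset.setIidPr BE) -/m m_1.
    by rewrite -[RHS]addr0 => /addrI.
  by move=> /psumr_eq0P; apply=> //; rewrite !inE sB.
have w_lt1 : 0 < 1 - w by rewrite subr_gt0 lt_def eq_sym wn1 (le_trans wB).
have wn : 1 - w != 0 by rewrite gt_eqF.
exists p, (fun s => (x s - w * p s) / (1 - w)); split=> //; last first.
  by move=> s; rewrite [X in _ + X]mulrC divfK // addrC subrK.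
split=> [s|s sE|].
- rewrite divr_ge0 ?(ltW w_lt1) // subr_ge0 /p; case: ifP => _; last by rewrite mulr0.
  by rewrite mulrCA ler_piMr // ler_pdivrMr ?mul1r.
- by have [_ /(_ s sE) -> _] := pE; rewrite xnE // mulr0 subr0 mul0r.
- have [_ _ p1] := pE.
  by rewrite -mulr_suml sumrB x1 -mulr_sumr p1 mulr1 divff.
Qed.

End Prob.

(** * Hulls of unions of products of simplices *)

Section Mixed.
Local Open Scope ring_scope.
Variables (R : realType) (n k : nat) (S : {ffun 'I_k -> {set 'I_n}}).
Hypotheses (injS : injective S)
  (partS : finset.partition (S @: 'I_k) [set: 'I_n]%SET).
Local Notation bl := (bl partS).
Implicit Types (J : {set 'I_k}) (C D : 'I_k -> {set 'I_n}) (f : {ffun 'I_k -> 'I_n}).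
Implicit Types (s t r : 'I_n) (i j : 'I_k) (u x y : 'rV[R]_n).

(** The vertex of a product of simplices, over the blocks in [J], that selects
    the element [f j] of the block [j]. *)
Definition vtx J f : 'rV[R]_n := \sum_(j in J) e R (f j).

(** Selections that lie in [C i] for one block [i] and in [D j] for all other
    blocks [j] of [J]. The values of [f] outside [J] are irrelevant. *)
Definition adm J C D f :=
  [exists i in J, (f i \in C i) && [forall j in J, (j != i) ==> (f j \in D j)]].

(** The convex hull of the union, over [i] in [J], of the products of simplices
    with factor [C i] at [i] and [D j] at the other blocks [j]. With
    [B j = S j :\: A j], the choices [(B, S)] and [(S, A)] give the deep
    truncation and the fragment along [A], and a one-element [J] gives the
    simplex on [C i]. *)
Definition mixed J C D : set 'rV[R]_n :=
  conv [set vtx J f | f in [set f | adm J C D f]].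

Lemma admP J C D f : reflect (exists i, [/\ i \in J, f i \in C i &
  forall j, j \in J -> j != i -> f j \in D j]) (adm J C D f).
Proof.
apply: (iffP exists_inP) => [[i iJ /andP[fi /forall_inP fD]]|[i [iJ fi fD]]];
  exists i => //; first by split=> // j jJ; apply/implyP/fD.
by rewrite fi /=; apply/forall_inP => j jJ; apply/implyP; apply: fD.
Qed.

Lemma dot_vtx J f u : dot u (vtx J f) = \sum_(j in J) u 0 (f j).
Proof. by rewrite dot_sumr; apply: eq_bigr => j _; rewrite dotC dot_e. Qed.

Lemma vtxE J f r : vtx J f 0 r = \sum_(j in J) (f j == r)%:R.
Proof. by rewrite summxE; apply: eq_bigr => j _; rewrite e_coord eq_sym. Qed.

(** Under a product distribution on selections, the coordinate [j] has
    distribution [q j]. *)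
Lemma sum_prod_marginal (q : 'I_k -> 'I_n -> R) j r :
  (forall i, \sum_s q i s = 1) ->
  \sum_(f : {ffun 'I_k -> 'I_n}) (\prod_i q i (f i)) * (f j == r)%:R = q j r.
Proof.
move=> q1; pose g i s := q i s * (if i == j then (s == r)%:R else 1).
transitivity (\sum_(f : {ffun 'I_k -> 'I_n}) \prod_i g i (f i)).
  apply: eq_bigr => f _; rewrite big_split /=; congr (_ * _).
  rewrite (bigD1 j) //= eqxx big1 ?mulr1 // => i /negbTE ->; by [].
rewrite -bigA_distr_bigA (bigD1 j) //= [X in _ * X]big1 => [|i /negbTE ij].
  rewrite mulr1 (bigD1 r) //= /g !eqxx mulr1 big1 ?addr0 // => s /negbTE ->.
  by rewrite mulr0.
by rewrite -(q1 i); apply: eq_bigr => s _; rewrite /g ij mulr1.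
Qed.

(** A product of simplices is the convex hull of its vertices. *)
Lemma prod_simplex_conv J (E : 'I_k -> {set 'I_n}) (q : 'I_k -> 'I_n -> R) :
  (forall j, j \in J -> E j \subset S j) ->
  (forall j, j \in J -> prob (E j) (q j)) ->
  conv [set vtx J f | f in [set f : {ffun 'I_k -> 'I_n} |
                               forall j, j \in J -> f j \in E j]]
    (\row_r (if bl r \in J then q (bl r) r else 0)).
Proof.
move=> ES qE; have [rep repS] := boolp.choice (block_neq0 partS).
pose q' j := if j \in J then q j else (fun s => (s == rep j)%:R).
have q'P j : prob (if j \in J then E j else S j) (q' j).
  by rewrite /q'; case: ifPn => jJ; [apply: qE|apply: prob_delta].
have q'1 j : \sum_s q' j s = 1 by have [] := q'P j.
pose a (f : {ffun 'I_k -> 'I_n}) := \prod_j q' j (f j).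
have -> : \row_r (if bl r \in J then q (bl r) r else 0) =
    \sum_(f : {ffun 'I_k -> 'I_n}) a f *: vtx J f.
  apply/rowP => r; rewrite mxE summxE.
  transitivity (\sum_(j in J) q' j r).
    case: ifPn => rJ.
      rewrite (bigD1 (bl r)) //= big1 => [|j /andP[jJ jr]].
        by rewrite addr0 /q' rJ.
      have [_ + _] := q'P j; rewrite jJ => -> //.
      apply: contra jr => /(fintype.subsetP (ES j jJ)).
      by rewrite (in_block injS) eq_sym.
    rewrite big1 // => j jJ; have [_ + _] := q'P j; rewrite jJ => -> //.
    apply: contra rJ => /(fintype.subsetP (ES j jJ)).
    by rewrite (in_block injS) => /eqP ->.
  under eq_bigr => j _ do rewrite -(sum_prod_marginal j r q'1).
  rewrite exchange_big /=; apply: eq_bigr => f _.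
  by rewrite mxE vtxE mulr_sumr.
apply: conv_sum => [f|f|].
- move=> /prodf_neq0 af; apply: sub_conv; exists f => // j jJ.
  apply: contraT => fj; have := af j isT; have [_ + _] := q'P j.
  by rewrite jJ => -> //; rewrite eqxx.
- by apply: prodr_ge0 => j _; have [] := q'P j.
- by rewrite -bigA_distr_bigA big1.
Qed.

(** If each block of a point is a mixture, with weights [w j] and [1 - w j], of
    a point [p j] of the simplex on [C j] and a point [z j] of the simplex on
    [D j], and if the [w j] add up to one, then the point is the convex
    combination with weights [w i] of the points equal to [p i] in the block [i]
    and to [z j] in the other blocks. *)
Lemma mixture J C D (w : 'I_k -> R) (p z : 'I_k -> 'I_n -> R) :
  (forall j, j \in J -> C j \subset S j) -> (forall j, j \in J -> D j \subset S j) ->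
  (forall j, j \in J -> 0 <= w j) -> \sum_(j in J) w j = 1 ->
  (forall j, j \in J -> prob (C j) (p j)) ->
  (forall j, j \in J -> prob (D j) (z j)) ->
  mixed J C D (\row_r (if bl r \in J then
     w (bl r) * p (bl r) r + (1 - w (bl r)) * z (bl r) r else 0)).
Proof.
move=> CS DS w0 w1 pC zD.
pose y i : 'rV[R]_n := \row_r (if bl r \in J then
   (if bl r == i then p (bl r) r else z (bl r) r) else 0).
have -> : \row_r (if bl r \in J then
     w (bl r) * p (bl r) r + (1 - w (bl r)) * z (bl r) r else 0) =
   \sum_i (if i \in J then w i else 0) *: y i.
  apply/rowP => r; rewrite mxE summxE; case: ifPn => rJ; last first.
    by rewrite big1 // => i _; rewrite !mxE (negbTE rJ) mulr0.
  rewrite (bigD1 (bl r)) //= !mxE rJ eqxx; congr (_ + _).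
  move: w1; rewrite (bigD1 (bl r)) //= => /eqP; rewrite eq_sym addrC -subr_eq => /eqP->.
  rewrite mulr_suml [RHS](bigID (mem J)) /= [X in _ = _ + X]big1 ?addr0; last first.
    by move=> i /andP[_ /negbTE->]; rewrite scale0r mxE.
  apply: eq_big => [i|i /andP[iJ ir]]; first by rewrite andbC.
  by rewrite iJ !mxE rJ eq_sym (negbTE ir).
apply: conv_sum => [i|i|].
- case: ifPn => [iJ _|]; last by rewrite eqxx.
  (* The point [y i] lies in the product of simplices that selects [C] at [i]. *)
  pose E j := if j == i then C j else D j.
  pose q j := if j == i then p j else z j.
  have -> : y i = \row_r (if bl r \in J then q (bl r) r else 0).
    by apply/rowP => r; rewrite !mxE /q; case: (bl r \in J); case: (bl r == i).
  have := @prod_simplex_conv J E q; rewrite /E /q.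
  case=> [j jJ|j jJ|m [v [a [vX a0 a1 ->]]]].
  + by case: eqP => _; [apply: CS | apply: DS].
  + by case: eqP => _; [apply: pC | apply: zD].
  exists m, v, a; split=> // l; have [f fE <-] := vX l; exists f => //=.
  apply/admP; exists i; split=> //; first by have := fE i iJ; rewrite eqxx.
  by move=> j jJ ji; have := fE j jJ; rewrite (negbTE ji).
- by case: ifP => // iJ; apply: w0.
- by rewrite -big_mkcond.
Qed.

Lemma simplexP (I : {set 'I_n}) x : simplex R I x <-> prob I (fun s => x 0 s).
Proof.
split=> [Ix|[x0 xI x1]].
  have ge0 s : 0 <= x 0 s.
    rewrite -dot_e; apply: conv_ge Ix => _ [r _ <-].
    by rewrite dot_e e_coord ler0n.
  have nI s : s \notin I -> x 0 s = 0.
    move=> sI; apply/eqP; rewrite eq_le ge0 andbT -lerN2 oppr0 -dot_e -dotNl.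
    apply: conv_ge Ix => _ [r rI <-]; rewrite dotNl dot_e e_coord.
    by case: eqP rI sI => [<- /= ->//|]; rewrite oppr0.
  split=> //; have [m [p [a [pX a0 a1 ->]]]] := Ix.
  under eq_bigr => s _ do rewrite summxE.
  rewrite exchange_big /= -a1; apply: eq_bigr => i _.
  have [r _ <-] := pX i; rewrite (bigD1 r) //= big1 => [|s sr].
    by rewrite mxE e_coord eqxx mulr1 addr0.
  by rewrite mxE e_coord (negbTE sr) mulr0.
rewrite (row_sum_e x); apply: conv_sum => // s xs; apply: sub_conv.
by exists s => //=; apply: contraNT xs => /xI ->.
Qed.

Lemma prod_simplexP J x : prod_simplex S J x <->
  [/\ forall s, 0 <= x 0 s, forall s, bl s \notin J -> x 0 s = 0
    & forall j, j \in J -> \sum_(s in S j) x 0 s = 1].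
Proof.
split=> [[xS xn]|[x0 xn x1]]; last first.
  split=> [i iJ|s sJ]; last first.
    apply: xn; apply/negP => blJ; have := sJ _ blJ.
    by rewrite (mem_bl partS).
  apply/simplexP; split=> [s|s sS|].
  - by rewrite mxE; case: ifP.
  - by rewrite mxE (negbTE sS).
  - rewrite -(x1 i iJ) [RHS]big_mkcond; apply: eq_bigr => s _.
    by rewrite mxE.
have xn' s : bl s \notin J -> x 0 s = 0.
  move=> sJ; apply: xn => i iJ; rewrite (in_block injS).
  by apply: contraNneq sJ => ->.
split=> // [s|j jJ].
  case: (boolP (bl s \in J)) => [sJ|/xn' -> //].
  have /simplexP[/(_ s) + _ _] := xS _ sJ; by rewrite mxE (mem_bl partS).
have /simplexP[_ _ <-] := xS _ jJ.
by rewrite big_mkcond; apply: eq_bigr => s _; rewrite mxE.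
Qed.

Lemma mixed_const J C D u b :
  (forall f, adm J C D f -> dot u (vtx J f) = b) ->
  forall x, mixed J C D x -> dot u x = b.
Proof.
move=> ub x Px; apply/eqP; rewrite eq_le; apply/andP; split.
  rewrite -lerN2 -dotNl; apply: conv_ge Px => _ [f fa <-].
  by rewrite dotNl ub.
by apply: conv_ge Px => _ [f fa <-]; rewrite ub.
Qed.

End Mixed.
Arguments vtx R {n k}.
Arguments mixed R {n k}.

(** * Deformations *)

Section Deformation.
Local Open Scope ring_scope.
Variables (R : realType) (n : nat).
Implicit Types (P Q : set 'rV[R]_n) (u v : 'rV[R]_n).

(** Inclusions between faces of [P] carry over to its deformations. *)
Lemma deformation_face P Q u v : deformation P Q ->
  face P u `<=` face P v -> face Q u `<=` face Q v.
Proof.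
case=> _ crs uv; have [D DP NQ] := crs _ (ex_intro2 _ _ u I erefl).
have : normal_cone Q (face Q u) u by move=> x [].
rewrite NQ => -[X DX Xu]; have [u' _ Xu'] := DP _ DX.
rewrite -Xu' in Xu.
have Nv : normal_cone P (face P u') v.
  move=> x Fx; have Fxu : face P u x by split; [case: Fx | apply: Xu].
  by have [] := uv _ Fxu.
have : normal_cone Q (face Q u) v by rewrite NQ; exists X => //; rewrite -Xu'.
by move=> NQv x Fx; split; [case: Fx | apply: NQv].
Qed.

End Deformation.

(** * Vertices, indecomposability and minimizers of these hulls *)

Section MixedPolytopes.
Local Open Scope ring_scope.
Variables (R : realType) (n k : nat) (S : {ffun 'I_k -> {set 'I_n}}).
Hypotheses (injS : injective S)
  (partS : finset.partition (S @: 'I_k) [set: 'I_n]%SET).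
Local Notation bl := (bl partS).
Local Notation lvl := (lvl partS).
Implicit Types (f g : {ffun 'I_k -> 'I_n}).
Implicit Types (s t r : 'I_n) (i j : 'I_k) (u v x y : 'rV[R]_n).

Section General.
Variables (J : {set 'I_k}) (C D : 'I_k -> {set 'I_n}).
Hypotheses (CS : forall j, j \in J -> C j \subset S j)
  (DS : forall j, j \in J -> D j \subset S j).

Lemma adm_bl f j : adm J C D f -> j \in J -> bl (f j) = j.
Proof.
move=> /admP[i [iJ fi fD]] jJ; apply/eqP; rewrite -(in_block injS).
have [->|ji] := eqVneq j i; first exact: (fintype.subsetP (CS iJ)).
exact: (fintype.subsetP (DS jJ) _ (fD j jJ ji)).
Qed.

Lemma vtx_coord f r : adm J C D f ->
  vtx R J f 0 r = ((bl r \in J) && (f (bl r) == r))%:R.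
Proof.
move=> fa; rewrite vtxE; case: (boolP (bl r \in J)) => rJ /=.
  rewrite (bigD1 (bl r)) //= big1 ?addr0 // => j /andP[jJ jr].
  by case: (f j =P r) jr => // <-; rewrite (adm_bl fa jJ) eqxx.
rewrite big1 // => j jJ; case: eqP rJ => // <-.
by rewrite (adm_bl fa jJ) jJ.
Qed.

Lemma mixed_prod x : mixed R J C D x -> prod_simplex S J x.
Proof.
move=> Px; apply/(prod_simplexP injS partS); split=> [s|s sJ|j jJ].
- rewrite -dot_e; apply: conv_ge Px => _ [f fa <-].
  by rewrite dot_e vtx_coord // ler0n.
- rewrite -dot_e; apply: mixed_const Px => f fa.
  by rewrite dot_e vtx_coord // (negbTE sJ).
- rewrite -dot_sum_e; apply: mixed_const Px => f fa.
  rewrite dot_sum_e (bigD1 (f j)) /=; last by rewrite (in_block injS) (adm_bl fa).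
  rewrite vtx_coord // (adm_bl fa jJ) jJ eqxx big1 ?addr0 // => s /andP[sj sf].
  rewrite vtx_coord //; move: sj; rewrite (in_block injS) => /eqP ->.
  by rewrite eq_sym (negbTE sf) andbF.
Qed.

Hypothesis exadm : exists f, adm J C D f.

Lemma vtx_finite :
  finite_set [set vtx R J f | f in [set f | adm J C D f]] /\
  [set vtx R J f | f in [set f | adm J C D f]] !=set0.
Proof.
split; last by have [f fa] := exadm; exists (vtx R J f), f.
exact/finite_image/finite_finset.
Qed.

Lemma mixed_polytope : is_polytope (mixed R J C D).
Proof. by eexists; last reflexivity; apply: vtx_finite. Qed.

Lemma vtx_mixed f : adm J C D f -> mixed R J C D (vtx R J f).
Proof. by move=> fa; apply: sub_conv; exists f. Qed.

Lemma mixed_face_vtx u : exists2 f, adm J C D f & face (mixed R J C D) u (vtx R J f).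
Proof.
have [_ [f fa <-] fmin] := conv_min u vtx_finite.1 vtx_finite.2.
by exists f => //; apply: faceP => //; apply: vtx_mixed.
Qed.

Lemma supp_mixed u f : adm J C D f ->
  (forall g, adm J C D g -> \sum_(j in J) u 0 (f j) <= \sum_(j in J) u 0 (g j)) ->
  supp (mixed R J C D) u = \sum_(j in J) u 0 (f j).
Proof.
move=> fa fmin; rewrite -dot_vtx; apply: suppE; first exact: vtx_mixed.
by apply: conv_ge => _ [g ga <-]; rewrite !dot_vtx fmin.
Qed.

(** A vertex is the only minimizer of the sum of the coordinates that vanish at
    it. *)
Lemma vtx_unique_face f : adm J C D f ->
  exists u, forall x, face (mixed R J C D) u x -> x = vtx R J f.
Proof.
move=> fa; pose sel r := (bl r \in J) && (f (bl r) == r).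
exists (\sum_(r | ~~ sel r) e R r) => x [Px xu].
have [x0 xn x1] := (prod_simplexP injS partS J x).1 (mixed_prod Px).
have suppu : supp (mixed R J C D) (\sum_(r | ~~ sel r) e R r) = 0.
  have vtx0 : dot (\sum_(r | ~~ sel r) e R r) (vtx R J f) = 0.
    by rewrite dot_sum_e big1 // => r; rewrite /sel vtx_coord // => /negbTE ->.
  rewrite -vtx0; apply: suppE => [|y Py]; first exact: vtx_mixed.
  have [y0 _ _] := (prod_simplexP injS partS J y).1 (mixed_prod Py).
  by rewrite vtx0 dot_sum_e; apply: sumr_ge0.
have xnsel r : ~~ sel r -> x 0 r = 0.
  move: xu; rewrite suppu dot_sum_e => /psumr_eq0P; apply=> //.
apply/rowP => r; rewrite vtx_coord // -/(sel r).
case: (boolP (sel r)) => [/andP[rJ /eqP fr]|/xnsel //].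
rewrite -(x1 _ rJ) (bigD1 r) /= ?(mem_bl partS) // big1 ?addr0 // => s /andP[sr ns].
apply: xnsel; move: sr; rewrite (in_block injS) => /eqP sr.
by rewrite /sel sr fr eq_sym (negbTE ns) andbF.
Qed.

Section Indecomposable.
Variable i0 : 'I_k.
Hypothesis i0J : i0 \in J.

(** Weights on the blocks that give, for every [v], the same value to all
    vertices of the face in direction [v]. *)
Definition edge_compatible (m : 'I_k -> R) := forall v f g,
  adm J C D f -> adm J C D g ->
  face (mixed R J C D) v (vtx R J f) -> face (mixed R J C D) v (vtx R J g) ->
  \sum_(l in J) m l * v 0 (f l) = \sum_(l in J) m l * v 0 (g l).

(** Let [Q] be a deformation, and [q f] a point of [Q] that minimizes every
    functional minimized by the vertex [f]. The functionals [e r] and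
    [e_(S_j)] force [q f = c + \sum_j m j *: e (f j)] with [c] and [m]
    independent of [f]; compatibility with the edges between blocks then makes
    [m] constant, so that [Q] is a point or a translate of a dilate. *)
Lemma mixed_indecomposable :
  (forall y, (forall v, supp (mixed R J C D) v <= dot v y) -> mixed R J C D y) ->
  (forall m, edge_compatible m -> forall i, i \in J -> m i = m i0) ->
  indecomposable (mixed R J C D).
Proof.
set P := mixed R J C D => Hclose exch Q dPQ; have [polQ _] := dPQ.
have coordP x : P x -> [/\ forall s, 0 <= x 0 s, forall s, bl s \notin J -> x 0 s = 0
    & forall j, j \in J -> \sum_(s in S j) x 0 s = 1].
  by move=> Px; apply/(prod_simplexP injS partS)/mixed_prod.
have ex_q f : exists y, adm J C D f ->
    forall v, face P v (vtx R J f) -> face Q v y.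
  have [fa|nfa] := boolP (adm J C D f); last by exists 0.
  have [u uf] := vtx_unique_face fa; have [y Qy yu] := supp_attained u polQ.
  exists y => _ v fv; apply: (deformation_face dPQ) (_ : face Q u y) => [x /uf->//|].
  by split.
have [q qP] := boolp.choice ex_q.
pose c : 'rV[R]_n := \row_r (supp Q (e R r) : R).
pose m j : R := supp Q (eblock R S j) - \sum_(s in S j) c 0 s.
have Qq f : adm J C D f -> Q (q f).
  move=> fa; have [u uf] := vtx_unique_face fa.
  have [|//] := qP f fa 0; apply: faceP; first exact: vtx_mixed.
  by move=> y _; rewrite -[0 : 'rV_n](scale0r 0) !dotZl !mul0r.
have qE f : adm J C D f -> q f = c + \sum_(j in J) m j *: e R (f j).
  move=> fa; have [v0 vn v1] := coordP _ (vtx_mixed fa).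
  (* The vertex [f] minimizes each coordinate that it does not select. *)
  have nsel r : ~~ ((bl r \in J) && (f (bl r) == r)) -> q f 0 r = c 0 r.
    move=> /negbTE nr; have [] := qP f fa (e R r); last by rewrite dot_e mxE.
    apply: faceP; first exact: vtx_mixed.
    move=> y /coordP[y0 _ _]; by rewrite !dot_e vtx_coord // nr.
  apply/rowP => r; rewrite [RHS]mxE summxE.
  case: (boolP ((bl r \in J) && (f (bl r) == r))) => [/andP[rJ /eqP fr]|nr]; last first.
    rewrite nsel // big1 ?addr0 // => j jJ; rewrite scale_e_coord.
    case: eqP => [rE|]; last by rewrite mulr0.
    by move: nr; rewrite rE (adm_bl fa jJ) jJ eqxx.
  rewrite (bigD1 (bl r)) //= big1 ?addr0 => [|j /andP[jJ jr]]; last first.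
    rewrite scale_e_coord; case: eqP => [rE|]; last by rewrite mulr0.
    by move: jr; rewrite rE (adm_bl fa jJ) eqxx.
  rewrite scale_e_coord fr eqxx mulr1 /m.
  (* All of the polytope lies in the face in direction [e_(S_j)]. *)
  have [_ <-] : face Q (eblock R S (bl r)) (q f).
    apply: qP => //; apply: faceP; first exact: vtx_mixed.
    by move=> y /coordP[_ _ y1]; rewrite !dot_sum_e v1 // y1.
  rewrite dot_sum_e !(bigD1 (P := mem (S (bl r))) r) /=; try exact: mem_bl.
  rewrite (eq_bigr (fun s => c 0 s)) => [|s /andP[+ sr]].
    by rewrite addrA addrAC; ring.
  rewrite (in_block injS) => /eqP sE; apply: nsel.
  by rewrite sE fr eq_sym (negbTE sr) andbF.
have exch_m : edge_compatible m.
  move=> v f g fa ga fv gv; have [_ qf] := qP f fa v fv; have [_ qg] := qP g ga v gv.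
  have dE (h : {ffun 'I_k -> 'I_n}) :
      dot v (\sum_(l in J) m l *: e R (h l)) = \sum_(l in J) m l * v 0 (h l).
    by rewrite dot_sumr; apply: eq_bigr => l _; rewrite dotZr dotC dot_e.
  by move: (etrans qf (esym qg)); rewrite !qE // !dotDr => /addrI; rewrite !dE.
have mE := exch m exch_m; pose lam := m i0.
have qE' f : adm J C D f -> q f = lam *: vtx R J f + c.
  move=> fa; rewrite qE // addrC scaler_sumr; congr (_ + _).
  by apply: eq_bigr => j /mE ->.
have lam0 : 0 <= lam.
  have [f fa] := exadm; have := supp_le (e R (f i0)) polQ (Qq f fa).
  rewrite qE' // dotDr dotZr !dot_e vtx_coord // adm_bl // i0J eqxx mulr1.
  by rewrite [c _ _]mxE lerDr.
have Qle x v : Q x -> lam * supp P v + dot v c <= dot v x.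
  move=> Qx; have [f fa fv] := mixed_face_vtx v.
  have [_ qv] := qP f fa v fv; have [_ <-] := fv.
  by rewrite -dotZr -dotDr -qE' // qv; apply: supp_le.
have [lam_0|lamn0] := eqVneq lam 0.
  left; exists c; apply/seteqP; split=> [x Qx|_ ->].
    apply/rowP => r; apply/eqP; rewrite eq_le; apply/andP; split.
      have := Qle x (- e R r) Qx; rewrite lam_0 mul0r add0r !dotNl !dot_e lerN2.
      exact.
    by have := Qle x (e R r) Qx; rewrite lam_0 mul0r add0r !dot_e.
  have [f fa] := exadm; have := Qq f fa.
  by rewrite qE' // lam_0 scale0r add0r.
have lam_gt0 : 0 < lam by rewrite lt_def lamn0.
right; exists lam, c; split=> //; apply/seteqP; split=> [x Qx|_ [y Py <-]].
  exists (lam^-1 *: (x - c)); last by rewrite scalerA divff // scale1r subrK.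
  apply: Hclose => v; rewrite dotZr -(ler_pM2l lam_gt0) mulrA divff // mul1r.
  rewrite dotDr -[X in _ + dot v X]scaleN1r dotZr mulN1r lerBrDr.
  exact: Qle.
have [l [p [a [pX a0 a1 ->]]]] := Py; have [Y _ QY] := polQ.
have -> : lam *: (\sum_i a i *: p i) + c = \sum_i a i *: (lam *: p i + c).
  rewrite scaler_sumr -[c in LHS]scale1r -a1 scaler_suml -big_split /=.
  by apply: eq_bigr => i _; rewrite scalerDr !scalerA mulrC.
rewrite QY; apply: conv_sum => // i _; rewrite -QY.
by have [f fa <-] := pX i; rewrite -qE' //; apply: Qq.
Qed.

End Indecomposable.

(** For each chain, choose [c0 j] and [d0 j] of least level in [C j] and [D j].
    Among the vertices made of these, the one that uses [c0] at [i0] minimizes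
    the whole cone as soon as it does so among these vertices. *)
Lemma mixed_sim :
  (forall j, j \in J -> C j != finset.set0) ->
  (forall j, j \in J -> D j != finset.set0) ->
  (forall c (c0 d0 : 'I_k -> 'I_n), chain S c ->
    (forall j, j \in J -> c0 j \in C j /\
       forall s, s \in C j -> (lvl c (c0 j) <= lvl c s)%N) ->
    (forall j, j \in J -> d0 j \in D j /\
       forall s, s \in D j -> (lvl c (d0 j) <= lvl c s)%N) ->
    exists2 i0, i0 \in J & forall u, chain_cone S c u ->
      forall i, i \in J -> u 0 (c0 i0) + u 0 (d0 i) <= u 0 (c0 i) + u 0 (d0 i0)) ->
  simultaneous_min S (mixed R J C D).
Proof.
move=> Cn0 Dn0 H c hc.
have argmin (E : 'I_k -> {set 'I_n}) : (forall j, j \in J -> E j != finset.set0) ->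
    exists c0 : 'I_k -> 'I_n, forall j, j \in J -> c0 j \in E j /\
       forall s, s \in E j -> (lvl c (c0 j) <= lvl c s)%N.
  move=> En0; have [f _] := exadm.
  suff ex_s j : exists s, j \in J -> s \in E j /\
      forall t, t \in E j -> (lvl c s <= lvl c t)%N.
    by have [c0 c0P] := boolp.choice ex_s; exists c0.
  case: (boolP (j \in J)) => [/En0/finset.set0Pn[s0 s0E]|_]; last by exists (f j).
  have [s sE smin] := @arg_minnP _ s0 (mem (E j)) (lvl c) s0E.
  by exists s.
have [c0 c0P] := argmin C Cn0; have [d0 d0P] := argmin D Dn0.
have [i0 i0J i0P] := H c c0 d0 hc c0P d0P.
pose f := [ffun j => if j == i0 then c0 j else d0 j].
have fa : adm J C D f.
  apply/admP; exists i0; split=> [//||j jJ ji]; rewrite ffunE ?eqxx ?(negbTE ji).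
    by have [] := c0P i0 i0J.
  by have [] := d0P j jJ.
exists (vtx R J f); first exact: vtx_mixed.
move=> u uc; apply: conv_ge => _ [g /admP[i [iJ gi gD]] <-]; rewrite !dot_vtx.
have [p [om [uE pmono _]]] := chain_cone_lvl injS partS hc uc.
have ule s t : bl s = bl t -> (lvl c s <= lvl c t)%N -> u 0 s <= u 0 t.
  by move=> st /pmono; rewrite !uE st lerD2r.
have blC j s : j \in J -> s \in C j -> bl s = j.
  by move=> jJ /(fintype.subsetP (CS jJ)); rewrite (in_block injS) => /eqP.
have blD j s : j \in J -> s \in D j -> bl s = j.
  by move=> jJ /(fintype.subsetP (DS jJ)); rewrite (in_block injS) => /eqP.
pose h j := u 0 (d0 j).
have fE : \sum_(j in J) u 0 (f j) = \sum_(j in J) h j + (u 0 (c0 i0) - h i0).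
  rewrite (bigD1 i0) //= [in RHS](bigD1 i0) //= ffunE eqxx.
  rewrite (eq_bigr h) => [|j /andP[_ /negbTE ji]]; last by rewrite ffunE ji.
  ring.
have gE : \sum_(j in J) h j + (u 0 (c0 i) - h i) <= \sum_(j in J) u 0 (g j).
  rewrite (bigD1 i) //= [in leRHS](bigD1 i) //= addrAC addrCA subrr addr0.
  have [c0C c0m] := c0P i iJ.
  apply: lerD; first by apply: ule (c0m _ gi); rewrite !(blC i).
  apply: ler_sum => j /andP[jJ ji]; have [d0D d0m] := d0P j jJ.
  by apply: ule (d0m _ (gD j jJ ji)); rewrite !(blD j) //; apply: gD.
rewrite fE; apply: le_trans gE; rewrite lerD2l.
by have := i0P u uc i iJ; rewrite /h; lra.
Qed.

End General.

End MixedPolytopes.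

(** * Deep truncations, fragments and simplices *)

Section Families.
Local Open Scope ring_scope.
Variables (R : realType) (n k : nat) (S : {ffun 'I_k -> {set 'I_n}}).
Hypotheses (injS : injective S)
  (partS : finset.partition (S @: 'I_k) [set: 'I_n]%SET).
Local Notation bl := (bl partS).
Local Notation lvl := (lvl partS).
Implicit Types (f g : {ffun 'I_k -> 'I_n}) (A M : {ffun 'I_k -> {set 'I_n}}).
Implicit Types (J : {set 'I_k}).
Implicit Types (s t r : 'I_n) (i j : 'I_k) (u v x y : 'rV[R]_n).

Lemma block_subset j : S j \subset S j. Proof. exact: fintype.subxx. Qed.

(** A point above the support function of [P] satisfies all linear inequalities
    valid on [P], in particular those that define the product of simplices. *)
Lemma prod_simplex_closed J (P : set 'rV[R]_n) y : is_polytope P ->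
  P `<=` prod_simplex S J -> (forall v, supp P v <= dot v y) ->
  prod_simplex S J y.
Proof.
move=> polP PS hy.
have ge v b : (forall x, P x -> b <= dot v x) -> b <= dot v y.
  by move=> /(le_supp polP)/le_trans; apply.
have eq v b : (forall x, P x -> dot v x = b) -> dot v y = b.
  move=> vb; apply/eqP; rewrite eq_le; apply/andP; split.
    by rewrite -lerN2 -dotNl; apply: ge => x /vb vx; rewrite dotNl vx.
  by apply: ge => x /vb ->.
apply/(prod_simplexP injS partS); split=> [s|s sJ|j jJ].
- rewrite -dot_e; apply: ge => x /PS /(prod_simplexP injS partS)[x0 _ _].
  by rewrite dot_e.
- rewrite -dot_e; apply: eq => x /PS /(prod_simplexP injS partS)[_ xn _].
  by rewrite dot_e xn.
- rewrite -dot_sum_e; apply: eq => x /PS /(prod_simplexP injS partS)[_ _ x1].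
  by rewrite dot_sum_e x1.
Qed.

(** The form in which [mixture] is applied: only the splittings are needed. *)
Lemma mixed_of_split J (C D : 'I_k -> {set 'I_n}) x (w : 'I_k -> R) :
  (forall j, j \in J -> C j \subset S j) -> (forall j, j \in J -> D j \subset S j) ->
  prod_simplex S J x ->
  (forall j, j \in J -> 0 <= w j) -> \sum_(j in J) w j = 1 ->
  (forall j, j \in J -> exists p z, [/\ prob (C j) p, prob (D j) z &
     forall s, (if s \in S j then x 0 s else 0) = w j * p s + (1 - w j) * z s]) ->
  mixed R J C D x.
Proof.
move=> CS DS /(prod_simplexP injS partS)[x0 xn x1] w0 w1 hpz.
have ex_pz j : exists pz : ('I_n -> R) * ('I_n -> R), j \in J ->
  [/\ prob (C j) pz.1, prob (D j) pz.2 & forall s,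
     (if s \in S j then x 0 s else 0) = w j * pz.1 s + (1 - w j) * pz.2 s].
  case: (boolP (j \in J)) => [/hpz[p [z pz]]|_]; first by exists (p, z).
  by exists (fun=> 0, fun=> 0).
have [pz pzP] := boolp.choice ex_pz.
have -> : x = \row_r (if bl r \in J then
     w (bl r) * (pz (bl r)).1 r + (1 - w (bl r)) * (pz (bl r)).2 r else 0).
  apply/rowP => r; rewrite mxE; case: ifPn => [rJ|/xn //].
  have [_ _ <-] := pzP _ rJ; by rewrite (mem_bl partS).
apply: (@mixture R n k S injS partS J C D w (fun j => (pz j).1)
  (fun j => (pz j).2)) => // j jJ; by have [] := pzP _ jJ.
Qed.

Lemma prob_block J x j : prod_simplex S J x -> j \in J ->
  prob (S j) (fun s => if s \in S j then x 0 s else 0).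
Proof.
move=> /(prod_simplexP injS partS)[x0 xn x1] jJ; split=> [s|s /negbTE->//|].
  by case: ifP.
by rewrite -big_mkcond x1.
Qed.

Section OneTuple.
Variables (J : {set 'I_k}) (A : {ffun 'I_k -> {set 'I_n}}) (j0 : 'I_k).
Hypotheses (j0J : j0 \in J) (AS : forall j, j \in J -> A j \proper S j)
  (A0 : forall j, j \in J -> A j != finset.set0).

Local Notation B := (fun j => S j :\: A j).

(** The functional that defines the deep truncation and the fragment. *)
Definition cutvec : 'rV[R]_n := \sum_(i in J) \sum_(s in S i :\: A i) e R s.

Lemma dot_cutvec x :
  dot cutvec x = \sum_(i in J) \sum_(s in S i :\: A i) x 0 s.
Proof. by rewrite dot_suml; apply: eq_bigr => i _; rewrite dot_sum_e. Qed.

Lemma cutvecE r : cutvec 0 r = ((bl r \in J) && (r \notin A (bl r)))%:R.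
Proof.
rewrite summxE; case: (boolP (bl r \in J)) => rJ /=.
  rewrite (bigD1 (bl r)) //= [X in _ + X]big1 ?addr0 => [|i /andP[iJ ir]].
    by rewrite coord_sum_e !inE (mem_bl partS) andbT.
  by rewrite coord_sum_e !inE (in_block injS) eq_sym (negbTE ir) andbF.
rewrite big1 // => i iJ; rewrite coord_sum_e !inE (in_block injS).
by case: eqP rJ => [->|]; rewrite ?iJ // andbF.
Qed.

Lemma tuple_sub j : j \in J -> A j \subset S j.
Proof. by move=> /AS/fintype.proper_sub. Qed.

Lemma diff_sub j : j \in J -> B j \subset S j.
Proof. by move=> _; apply: finset.subsetDl. Qed.

Lemma diff_neq0 j : j \in J -> B j != finset.set0.
Proof.
move=> /AS/fintype.properP[_ [s sS sA]].
by apply/finset.set0Pn; exists s; rewrite !inE sA.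
Qed.

Lemma block_set_neq0 j : j \in J -> S j != finset.set0.
Proof. by move=> _; apply/finset.set0Pn/(block_neq0 partS). Qed.

(** Vertices with exactly one coordinate off the face along which one cuts. *)
Lemma one_off i : i \in J -> exists f,
  f i \in B i /\ forall j, j \in J -> j != i -> f j \in A j.
Proof.
move=> iJ.
have ex_a j : exists s, j \in J -> s \in A j.
  case: (boolP (j \in J)) => [/A0/finset.set0Pn[s sA]|_]; first by exists s.
  by have [s _] := block_neq0 partS j; exists s.
have [a aP] := boolp.choice ex_a; have /finset.set0Pn[b bB] := diff_neq0 iJ.
exists [ffun j => if j == i then b else a j]; rewrite ffunE eqxx; split=> //.
by move=> j jJ ji; rewrite ffunE (negbTE ji) aP.
Qed.

Lemma sum_one_off i f (m : 'I_k -> R) : i \in J -> f i \in B i ->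
  (forall j, j \in J -> j != i -> f j \in A j) ->
  \sum_(l in J) m l * cutvec 0 (f l) = m i.
Proof.
move=> iJ fi fA; have blf j : j \in J -> f j \in S j -> bl (f j) = j.
  by move=> _; rewrite (in_block injS) => /eqP.
rewrite (bigD1 i) //= big1 ?addr0 => [|j /andP[jJ ji]].
  rewrite cutvecE blf //; last exact: (fintype.subsetP (diff_sub iJ)).
  by move: fi; rewrite !inE iJ => /andP[->]; rewrite mulr1.
rewrite cutvecE blf //; last exact: (fintype.subsetP (tuple_sub jJ) _ (fA j jJ ji)).
by rewrite fA // andbF mulr0.
Qed.

Lemma adm_DTr_off i f : i \in J -> f i \in B i ->
  (forall j, j \in J -> j != i -> f j \in A j) -> adm J B S f.
Proof.
move=> iJ fi fA; apply/admP; exists i; split=> // j jJ ji.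
exact: (fintype.subsetP (tuple_sub jJ) _ (fA j jJ ji)).
Qed.

Lemma adm_Fr_off i f : i \in J -> f i \in B i ->
  (forall j, j \in J -> j != i -> f j \in A j) -> adm J S A f.
Proof.
by move=> iJ fi fA; apply/admP; exists i; split=> //; move: fi; rewrite !inE => /andP[].
Qed.

Lemma DTr_vertex_exists : exists f, adm J B S f.
Proof. by have [f [fi fA]] := one_off j0J; exists f; apply: (adm_DTr_off j0J). Qed.

Lemma Fr_vertex_exists : exists f, adm J S A f.
Proof. by have [f [fi fA]] := one_off j0J; exists f; apply: (adm_Fr_off j0J). Qed.

Lemma dot_cutvec_vtx f : dot cutvec (vtx R J f) = \sum_(l in J) 1 * cutvec 0 (f l).
Proof. by rewrite dot_vtx; apply: eq_bigr => l _; rewrite mul1r. Qed.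

Lemma sum_diff_block x j : j \in J ->
  \sum_(s in B j) (if s \in S j then x 0 s else 0) = \sum_(s in B j) x 0 s.
Proof.
by move=> jJ; apply: eq_bigr => s /(fintype.subsetP (diff_sub jJ)) ->.
Qed.

(** The mass [b j] off [A j] is at least one in total, so the weights
    [b j / \sum_i b i] are at most [b j], and the mass of [S j :\: A j] can be
    split off with these weights. *)
Lemma DTr_mixed : DTr S J A = mixed R J B S.
Proof.
apply/seteqP; split=> [x [Px]|x Px]; last first.
  split; first exact: mixed_prod diff_sub (fun j _ => block_subset j) _ Px.
  rewrite -dot_cutvec; apply: conv_ge Px => _ [f fa <-].
  have blf := adm_bl injS partS diff_sub (fun j _ => block_subset j) fa.
  have [i [iJ fi _]] := admP _ _ _ _ fa.
  rewrite dot_vtx (bigD1 i) //= cutvecE blf // iJ.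
  move: fi; rewrite !inE => /andP[-> _]; rewrite lerDl; apply: sumr_ge0 => j _.
  by rewrite cutvecE ler0n.
pose b j := \sum_(s in B j) x 0 s; rewrite -/(\sum_(j in J) b j).
set bb := \sum_(j in J) b j => bb1; have bb0 : 0 < bb by apply: lt_le_trans bb1.
have [x0 xn x1] := (prod_simplexP injS partS J x).1 Px.
have b0 j : 0 <= b j by apply: sumr_ge0.
apply: (mixed_of_split (w := fun j => b j / bb)) => //.
- exact: diff_sub.
- by move=> j _; rewrite divr_ge0 // ltW.
- by rewrite -mulr_suml divff // gt_eqF.
move=> j jJ; apply: prob_split (prob_block Px jJ) (diff_sub jJ) (diff_neq0 jJ) _ _.
  by rewrite divr_ge0 // ltW.
by rewrite sum_diff_block // ler_pdivrMr // ler_peMr.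
Qed.

(** The mass [b j] off [A j] is at most one in total. Giving the missing mass to
    the block [j0] yields weights [w j] that are at least [b j], so that mass
    [1 - w j] can be split off [A j]. *)
Lemma Fr_mixed : Fr S J A = mixed R J S A.
Proof.
apply/seteqP; split=> [x [Px]|x Px]; last first.
  split; first exact: mixed_prod (fun j _ => block_subset j) tuple_sub _ Px.
  rewrite -dot_cutvec -lerN2 -dotNl; apply: conv_ge Px => _ [f fa <-].
  have blf := adm_bl injS partS (fun j _ => block_subset j) tuple_sub fa.
  have [i [iJ _ fA]] := admP _ _ _ _ fa.
  rewrite dotNl lerN2 dot_vtx (bigD1 i) //= big1 ?addr0 => [|j /andP[jJ ji]].
    by rewrite cutvecE lern1 leq_b1.
  by rewrite cutvecE blf // fA // andbF.
pose b j := \sum_(s in B j) x 0 s; rewrite -/(\sum_(j in J) b j).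
set bb := \sum_(j in J) b j => bb1.
have [x0 xn x1] := (prod_simplexP injS partS J x).1 Px.
have b0 j : 0 <= b j by apply: sumr_ge0.
pose w j := b j + (j == j0)%:R * (1 - bb).
have bw j : b j <= w j by rewrite lerDl mulr_ge0 // subr_ge0.
have w1 : \sum_(j in J) w j = 1.
  rewrite big_split /= -/bb -mulr_suml (bigD1 j0) //= eqxx big1 ?addr0 => [|j].
    by rewrite mul1r addrC subrK.
  by move=> /andP[_ /negbTE->].
apply: (mixed_of_split (w := w)) => //.
- exact: tuple_sub.
- by move=> j _; apply: le_trans (bw j).
move=> j jJ.
have w_le1 : w j <= 1.
  by rewrite -w1 (bigD1 j) //= lerDl; apply: sumr_ge0 => l _; apply: le_trans (bw l).
have [||p [z [pA zS pz]]] :=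
  @prob_split R n (S j) (A j) _ (1 - w j) (prob_block Px jJ) (tuple_sub jJ) (A0 jJ).
- by rewrite subr_ge0.
- rewrite lerBlDr; apply: le_trans (_ : _ <= \sum_(s in A j) x 0 s + b j) _.
    rewrite -(x1 j jJ) (big_setID (A j)) /= (finset.setIidPr (tuple_sub jJ)).
    exact: lexx.
  rewrite lerD // le_eqVlt; apply/orP; left; apply/eqP; apply: eq_bigr => s sA.
  by rewrite (fintype.subsetP (tuple_sub jJ)).
by exists z, p; split=> // s; rewrite pz opprB addrC subrKC.
Qed.

Lemma DTr_polytope : is_polytope (DTr S J A : set 'rV[R]_n).
Proof. rewrite DTr_mixed; exact: mixed_polytope DTr_vertex_exists. Qed.

Lemma Fr_polytope : is_polytope (Fr S J A : set 'rV[R]_n).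
Proof. rewrite Fr_mixed; exact: mixed_polytope Fr_vertex_exists. Qed.

Lemma DTr_indecomposable : indecomposable (DTr S J A : set 'rV[R]_n).
Proof.
rewrite DTr_mixed.
apply: (@mixed_indecomposable _ _ _ _ injS partS _ _ _ diff_sub _
  DTr_vertex_exists j0 j0J) => //.
  move=> y hy; rewrite -DTr_mixed; rewrite -DTr_mixed in hy; split.
    by apply: prod_simplex_closed hy => [|x []//]; apply: DTr_polytope.
  rewrite -dot_cutvec; apply: le_trans (hy _); apply: le_supp DTr_polytope _ => x [_].
  by rewrite dot_cutvec.
move=> m mE i iJ; have [f [fi fA]] := one_off iJ; have [g [gi gA]] := one_off j0J.
have face_off l (h : {ffun 'I_k -> 'I_n}) : l \in J -> h l \in B l ->
    (forall j, j \in J -> j != l -> h j \in A j) ->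
    face (mixed R J B S) cutvec (vtx R J h).
  move=> lJ hl hA; apply: faceP; first exact/vtx_mixed/(adm_DTr_off lJ).
  move=> y; rewrite -DTr_mixed => -[_]; rewrite -dot_cutvec.
  by rewrite dot_cutvec_vtx (sum_one_off _ lJ hl hA).
(* Moving the excess from [i] to [j0] stays in the face cut out. *)
have := mE cutvec f g (adm_DTr_off iJ fi fA) (adm_DTr_off j0J gi gA)
  (face_off _ _ iJ fi fA) (face_off _ _ j0J gi gA).
by rewrite (sum_one_off _ iJ fi fA) (sum_one_off _ j0J gi gA).
Qed.

Lemma Fr_indecomposable : indecomposable (Fr S J A : set 'rV[R]_n).
Proof.
rewrite Fr_mixed.
apply: (@mixed_indecomposable _ _ _ _ injS partS _ _ _ _ tuple_sub
  Fr_vertex_exists j0 j0J) => //.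
  move=> y hy; rewrite -Fr_mixed; rewrite -Fr_mixed in hy; split.
    by apply: prod_simplex_closed hy => [|x []//]; apply: Fr_polytope.
  rewrite -dot_cutvec -lerN2 -dotNl; apply: le_trans (hy _).
  by apply: le_supp Fr_polytope _ => x [_]; rewrite dotNl lerN2 dot_cutvec.
move=> m mE i iJ; have [f [fi fA]] := one_off iJ; have [g [gi gA]] := one_off j0J.
have face_off l (h : {ffun 'I_k -> 'I_n}) : l \in J -> h l \in B l ->
    (forall j, j \in J -> j != l -> h j \in A j) ->
    face (mixed R J S A) (- cutvec) (vtx R J h).
  move=> lJ hl hA; apply: faceP; first exact/vtx_mixed/(adm_Fr_off lJ).
  move=> y; rewrite -Fr_mixed => -[_]; rewrite -dot_cutvec !dotNl lerN2.
  by rewrite dot_cutvec_vtx (sum_one_off _ lJ hl hA).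
have := mE (- cutvec) f g (adm_Fr_off iJ fi fA) (adm_Fr_off j0J gi gA)
  (face_off _ _ iJ fi fA) (face_off _ _ j0J gi gA).
have sumN (h : {ffun 'I_k -> 'I_n}) : \sum_(l in J) m l * (- cutvec) 0 (h l) =
    - \sum_(l in J) m l * cutvec 0 (h l).
  by rewrite -[in RHS]sumrN; apply: eq_bigr => l _; rewrite mxE mulrN.
rewrite !sumN (sum_one_off _ iJ fi fA) (sum_one_off _ j0J gi gA).
exact: oppr_inj.
Qed.

Lemma DTr_sim : simultaneous_min S (DTr S J A : set 'rV[R]_n).
Proof.
rewrite DTr_mixed; apply: (mixed_sim injS) => //.
- exact: diff_sub.
- exact: DTr_vertex_exists.
- exact: diff_neq0.
- exact: block_set_neq0.
move=> c c0 d0 hc c0P d0P.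
(* [d0] has level zero, so the block where [c0] has least level is best. *)
have [i0 i0J i0min] := @arg_minnP _ j0 (mem J) (fun j => lvl c (c0 j)) j0J.
exists i0 => // u uc i iJ.
have [p [om [uE pmono p0]]] := chain_cone_lvl injS partS hc uc.
have blC j : j \in J -> bl (c0 j) = j.
  move=> jJ; have [/(fintype.subsetP (diff_sub jJ)) + _] := c0P j jJ.
  by rewrite (in_block injS) => /eqP.
have d00 j : j \in J -> u 0 (d0 j) = om j.
  move=> jJ; have [+ dmin] := d0P j jJ; rewrite (in_block injS) => /eqP bd.
  have [s sS s0] := lvl0 injS partS j hc; have := dmin s sS.
  by rewrite s0 leqn0 uE bd => /eqP/p0 ->; rewrite add0r.
by rewrite !d00 // !uE !blC // addrAC -!addrA lerD ?pmono ?i0min // addrC.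
Qed.

Lemma Fr_sim : simultaneous_min S (Fr S J A : set 'rV[R]_n).
Proof.
rewrite Fr_mixed; apply: (mixed_sim injS) => //.
- exact: tuple_sub.
- exact: Fr_vertex_exists.
- exact: block_set_neq0.
move=> c c0 d0 hc c0P d0P.
(* [c0] has level zero, so the block where [d0] has greatest level is best. *)
have [i0 i0J i0max] := @arg_maxnP _ j0 (mem J) (fun j => lvl c (d0 j)) j0J.
exists i0 => // u uc i iJ.
have [p [om [uE pmono p0]]] := chain_cone_lvl injS partS hc uc.
have blD j : j \in J -> bl (d0 j) = j.
  move=> jJ; have [/(fintype.subsetP (tuple_sub jJ)) + _] := d0P j jJ.
  by rewrite (in_block injS) => /eqP.
have c00 j : j \in J -> u 0 (c0 j) = om j.
  move=> jJ; have [+ cmin] := c0P j jJ; rewrite (in_block injS) => /eqP bc.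
  have [s sS s0] := lvl0 injS partS j hc; have := cmin s sS.
  by rewrite s0 leqn0 uE bc => /eqP/p0 ->; rewrite add0r.
rewrite !c00 // !uE !blD //; have := pmono _ _ (i0max i iJ); lra.
Qed.

End OneTuple.

Lemma mixed_simplex i (C D : 'I_k -> {set 'I_n}) :
  mixed R [set i]%SET C D = simplex R (C i).
Proof.
congr conv; apply/seteqP; split=> [_ [f /admP[j [/finset.set1P-> fi _]] <-]|_ [s sC <-]].
  by exists (f i) => //; rewrite /vtx big_set1.
exists [ffun=> s]; last by rewrite /vtx big_set1 ffunE.
by apply/admP; exists i; rewrite ffunE inE; split=> // j /finset.set1P->; rewrite eqxx.
Qed.

Section Simplices.
Variables (i : 'I_k) (I : {set 'I_n}).
Hypotheses (I0 : I != finset.set0) (IS : I \subset S i).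

Lemma const_sub j : j \in [set i]%SET -> I \subset S j.
Proof. by move=> /finset.set1P ->. Qed.

Lemma simplex_vertex_exists : exists f, adm [set i]%SET (fun=> I) (fun=> I) f.
Proof.
have /finset.set0Pn[s sI] := I0; exists [ffun=> s]; apply/admP; exists i.
by rewrite ffunE inE; split=> // j _ _; rewrite ffunE.
Qed.

Lemma simplex_polytope : is_polytope (simplex R I).
Proof.
rewrite -(mixed_simplex i (fun=> I) (fun=> I)).
exact: mixed_polytope simplex_vertex_exists.
Qed.

Lemma simplex_indecomposable : indecomposable (simplex R I).
Proof.
rewrite -(mixed_simplex i (fun=> I) (fun=> I)).
apply: (@mixed_indecomposable _ _ _ _ injS partS _ _ _ const_sub const_sub
  simplex_vertex_exists i).
- by rewrite inE.
- rewrite mixed_simplex => y hy.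
  have ge v b : (forall x, simplex R I x -> b <= dot v x) -> b <= dot v y.
    by move=> /(le_supp simplex_polytope)/le_trans; apply.
  have y0 s : 0 <= y 0 s.
    by rewrite -dot_e; apply: ge => x /simplexP[x0 _ _]; rewrite dot_e.
  have yI s : s \notin I -> y 0 s = 0.
    move=> sI; apply/eqP; rewrite eq_le y0 andbT -lerN2 oppr0 -dot_e -dotNl.
    by apply: ge => x /simplexP[_ xI _]; rewrite dotNl dot_e xI // oppr0.
  apply/simplexP; split=> //; pose one := \sum_(s in 'I_n) e R s.
  have oneE x : dot one x = \sum_s x 0 s by rewrite dot_sum_e.
  rewrite -oneE; apply/eqP; rewrite eq_le; apply/andP; split.
    rewrite -lerN2 -dotNl; apply: ge => x /simplexP[_ _ x1].
    by rewrite dotNl oneE x1.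
  by apply: ge => x /simplexP[_ _ x1]; rewrite oneE x1.
- by move=> m _ j /finset.set1P ->.
Qed.

Lemma simplex_sim : simultaneous_min S (simplex R I).
Proof.
rewrite -(mixed_simplex i (fun=> I) (fun=> I)).
apply: (mixed_sim injS const_sub const_sub simplex_vertex_exists) => // c c0 d0 _ _ _.
by exists i => [|u _ j /finset.set1P->]; rewrite ?inE.
Qed.

Lemma supp_simplex u s : s \in I -> (forall t, t \in I -> u 0 s <= u 0 t) ->
  supp (simplex R I) u = u 0 s.
Proof.
move=> sI smin; rewrite -[RHS]dot_e dotC.
apply: suppE; first by apply: sub_conv; exists s.
by apply: conv_ge => _ [t tI <-]; rewrite dotC dot_e dotC dot_e smin.
Qed.

End Simplices.

End Families.

(** * Alternating sums over subsets *)

Section AlternatingSum.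
Local Open Scope ring_scope.
Variables (R : realType) (T : finType).
Implicit Types (J K : {set T}) (j : T) (F : {set T} -> R).

(** The sum of [(-1)^|K| F K] over the subsets [K] of [J]. *)
Definition altsum J F : R := \sum_(K in powerset J) (- 1) ^+ #|K| * F K.

(** A function that ignores one element has alternating sum zero. *)
Lemma altsum_toggle J j F : j \in J ->
  (forall K, K \subset J -> j \notin K -> F (j |: K)%SET = F K) -> altsum J F = 0.
Proof.
move=> jJ Fj; rewrite /altsum (bigID (fun K : {set T} => j \in K)) /=.
rewrite (reindex_onto (fun K => j |: K)%SET (fun K => K :\ j)%SET) /=; last first.
  by move=> K /andP[_ jK]; rewrite finset.setD1K.
rewrite [X in X + _](eq_big (fun K : {set T} => (K \in powerset J) && (j \notin K))
  (fun K => - ((- 1) ^+ #|K| * F K))) /=; first by rewrite sumrN addNr.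
  move=> K; rewrite !inE finset.subUset finset.sub1set jJ eqxx /= andbT.
  congr (_ && _); apply/eqP/idP => [<-|jK]; first by rewrite !inE eqxx.
  by rewrite finset.setU1K.
move=> K; rewrite !inE finset.subUset finset.sub1set jJ eqxx /= andbT.
move=> /andP[KJ /eqP KE].
have jK : j \notin K by rewrite -KE !inE eqxx.
by rewrite Fj // cardsU1 jK exprS mulN1r mulNr.
Qed.

Lemma altsum_top J F : (forall K, F K = (K == J)%:R) -> altsum J F = (- 1) ^+ #|J|.
Proof.
move=> FE; rewrite /altsum (bigD1 J) ?inE //= FE eqxx mulr1 big1 ?addr0 //.
by move=> K /andP[_ /negbTE KJ]; rewrite FE KJ mulr0.
Qed.

Lemma altsumD J F G : altsum J (fun K => F K + G K) = altsum J F + altsum J G.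
Proof. by rewrite -big_split; apply: eq_bigr => K _; rewrite mulrDr. Qed.

Lemma eq_altsum J F G : (forall K, K \subset J -> F K = G K) ->
  altsum J F = altsum J G.
Proof. by move=> FG; apply: eq_bigr => K; rewrite inE => /FG ->. Qed.

Lemma altsumN J F : altsum J (fun K => - F K) = - altsum J F.
Proof. by rewrite -sumrN; apply: eq_bigr => K _; rewrite mulrN. Qed.

(** The number of elements of [K], less one if [b] holds and [K] is nonempty. *)
Definition excess (b : bool) K : nat := (#|K| - (b && (K != finset.set0)))%N.

(** The summand is [#|J :\: K| - 1 + (K == J)] if [J] has at least two elements
    and [1 - (K == J)] otherwise. All terms but the indicator of [K = J] are sums
    of functions that ignore some element of [J]. *)
Lemma altsum_excess J : J != finset.set0 ->
  altsum J (fun K => (excess (1 < #|J|)%N (J :\: K))%:R) != 0.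
Proof.
move=> J0.
have top : altsum J (fun K => (K == J)%:R) = (- 1) ^+ #|J| by apply: altsum_top.
have sgn0 : (- 1) ^+ #|J| != 0 :> R by rewrite signr_eq0.
have DK0 K : K \subset J -> (J :\: K == finset.set0) = (K == J).
  by move=> KJ; rewrite finset.setD_eq0 finset.eqEsubset KJ.
case: (ltnP 1 #|J|) => [J2|J1]; rewrite /excess /=.
  rewrite (@eq_altsum J _ (fun K => #|J :\: K|%:R + (- 1 + (K == J)%:R))); last first.
    move=> K KJ; rewrite natrB; last first.
      by case: (boolP (_ == _)) => //= h; rewrite card_gt0.
    by rewrite DK0 //; case: (K == J) => /=; ring.
  rewrite altsumD altsumD top.
  have -> : altsum J (fun=> - 1) = 0.
    by have /finset.set0Pn[j jJ] := J0; apply: (altsum_toggle jJ).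
  rewrite add0r; suff -> : altsum J (fun K => #|J :\: K|%:R) = 0 by rewrite add0r.
  pose G i K : R := (i \notin K)%:R.
  rewrite (@eq_altsum J _ (fun K => \sum_(i in J) G i K)); last first.
    move=> K _; rewrite -natr_sum -sum1_card big_mkcond [in RHS]big_mkcond /=.
    congr _%:R; apply: eq_bigr => i _; rewrite !inE.
    by case: (i \in K); case: (i \in J).
  rewrite /altsum; under eq_bigr => K _ do rewrite mulr_sumr.
  rewrite exchange_big big1 //= => i iJ.
  have /finset.set0Pn[j] : J :\ i != finset.set0.
    by rewrite -card_gt0; move: J2; rewrite (cardsD1 i) iJ.
  rewrite !inE => /andP[ji jJ]; apply: (altsum_toggle jJ) => K _ _.
  by rewrite /G !inE eq_sym (negbTE ji).
have {}J1 : #|J| = 1%N by apply/eqP; rewrite eqn_leq J1 card_gt0.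
rewrite (@eq_altsum J _ (fun K => 1 + - (K == J)%:R)); last first.
  move=> K KJ; rewrite subn0 -DK0 // -cards_eq0.
  have : (#|J :\: K| <= 1)%N by rewrite -J1 fintype.subset_leq_card ?finset.subsetDl.
  by case: #|J :\: K| => [|[]] //= _; rewrite ?subr0 ?subrr.
rewrite altsumD altsumN top.
have -> : altsum J (fun=> 1) = 0.
  by have /finset.set0Pn[j jJ] := J0; apply: (altsum_toggle jJ).
by rewrite add0r oppr_eq0.
Qed.

End AlternatingSum.

(** * Values on the rays and linear independence *)

Section Bases.
Local Open Scope ring_scope.
Variables (R : realType) (n k : nat) (S : {ffun 'I_k -> {set 'I_n}}).
Hypotheses (injS : injective S)
  (partS : finset.partition (S @: 'I_k) [set: 'I_n]%SET).
Local Notation bl := (bl partS).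
Local Notation tuples := {ffun 'I_k -> {set 'I_n}}.
Implicit Types (f g : {ffun 'I_k -> 'I_n}) (A M : tuples).
Implicit Types (s t r : 'I_n) (i j : 'I_k) (u v x y : 'rV[R]_n).

(** The total size of a tuple. *)
Definition weight A : nat := \sum_i #|A i|.

Lemma sub_weight A M : (forall i, A i \subset M i) -> (weight M <= weight A)%N -> A = M.
Proof.
move=> AM; have : (weight A <= weight M ?= iff [forall i, A i == M i])%N.
  by apply: leqif_sum => i _; apply: subset_leqif_cards.
move=> /geq_leqif -> /forallP h; apply/ffunP => i; exact/eqP.
Qed.

Lemma Slk_proper A j : valid S A -> j \in Slk S A -> A j \proper S j.
Proof.
move=> /forallP/(_ j)/andP[_ AS]; rewrite inE => nA.
by rewrite finset.properEneq nA.
Qed.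

Lemma valid_set_neq0 A j : valid S A -> A j != finset.set0.
Proof. by move=> /forallP/(_ j)/andP[]. Qed.

Lemma Slk_neq0 A : A != S -> exists j, j \in Slk S A.
Proof.
move=> nA; apply/finset.set0Pn; apply: contraNneq nA => /setP A0.
by apply/eqP/ffunP => j; have := A0 j; rewrite !inE => /negbFE/eqP.
Qed.

Lemma sum_uvec (J : {set 'I_k}) M f : valid S M ->
  (forall j, j \in J -> bl (f j) = j) ->
  \sum_(j in J) uvec R S M 0 (f j) = (\sum_(j in J) (f j \notin M j))%N%:R.
Proof.
move=> vM blf; rewrite natr_sum; apply: eq_bigr => j jJ.
by rewrite (uvecE R injS partS) // blf.
Qed.

Lemma in_valid A j s : valid S A -> s \in A j -> s \in S j.
Proof. by move=> /forallP/(_ j)/andP[_ /fintype.subsetP AS] /AS. Qed.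

(** The values of the support functions of the deep truncations on the rays form
    the incidence matrix of the order on tuples. *)
Lemma supp_DTr_uvec A M : valid S A -> A != S -> valid S M ->
  supp (DTr S (Slk S A) A) (uvec R S M) = [forall i, M i \subset A i]%:R.
Proof.
move=> vA nA vM; have [j0 j0J] := Slk_neq0 nA.
have pA j := @Slk_proper A j vA; have A0 j (_ : j \in Slk S A) := valid_set_neq0 j vA.
rewrite (DTr_mixed R injS partS pA).
have dS := @diff_sub n k S (Slk S A) A.
have bS j (_ : j \in Slk S A) := block_subset S j.
have blf g : adm (Slk S A) (fun j => S j :\: A j) S g ->
    forall j, j \in Slk S A -> bl (g j) = j.
  by move=> ga j; apply: (adm_bl injS partS dS bS).
have [m mM] := boolp.choice (fun i => valid_neq0 i vM).
pose sel i b := [ffun j => if j == i then b else m j] : {ffun 'I_k -> 'I_n}.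
have sel_adm i b : i \in Slk S A -> b \in S i :\: A i ->
    adm (Slk S A) (fun j => S j :\: A j) S (sel i b).
  move=> iJ bi; apply/admP; exists i; split=> [//||j jJ ji]; rewrite ffunE ?eqxx //.
  by rewrite (negbTE ji) (in_valid vM).
have val i b : i \in Slk S A -> (\sum_(j in Slk S A) (sel i b j \notin M j) =
    (b \notin M i))%N.
  move=> iJ; rewrite (bigD1 i) //= ffunE eqxx big1 ?addn0 // => j /andP[_ ji].
  by rewrite ffunE (negbTE ji) mM.
case: (boolP [forall i, M i \subset A i]) => [/forallP MA|].
  have /finset.set0Pn[b bB] := diff_neq0 pA j0J.
  have fa := sel_adm j0 b j0J bB.
  have bM : b \notin M j0.
    move: bB; rewrite inE => /andP[+ _]; apply: contra.
    exact: (fintype.subsetP (MA j0)).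
  rewrite (supp_mixed fa) => [|g ga].
    by rewrite sum_uvec ?val ?bM //; apply: blf.
  rewrite !sum_uvec //; try exact: blf.
  rewrite ler_nat val // bM; have [i [iJ gi _]] := admP _ _ _ _ ga.
  rewrite (bigD1 i) //=; suff -> : g i \notin M i by [].
  move: gi; rewrite inE => /andP[+ _]; apply: contra.
  exact: (fintype.subsetP (MA i)).
rewrite negb_forall => /existsP[i /fintype.subsetPn[b bM bA]].
have iJ : i \in Slk S A by rewrite inE; apply: contraNneq bA => ->; apply: in_valid bM.
have fa : adm (Slk S A) (fun j => S j :\: A j) S (sel i b).
  by apply: sel_adm => //; rewrite inE bA; apply: in_valid bM.
rewrite (supp_mixed fa) => [|g ga].
  by rewrite sum_uvec ?val ?bM //; apply: blf.
by rewrite !sum_uvec //; try exact: blf; rewrite ler_nat val // bM.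
Qed.

(** For one slack block, the fragment is replaced by the simplex on that block
    of [A]. *)
Definition Fr_or_simplex A : set 'rV[R]_n :=
  if (1 < slk S A)%N then Fr S (Slk S A) A else mixed R (Slk S A) A A.

(** The slack blocks on which [A] and [M] are disjoint. *)
Definition apart A M : {set 'I_k} := [set j in Slk S A | A j :&: M j == finset.set0]%SET.

(** A vertex of the fragment pays one for each block where it misses [M], which
    is forced on [apart A M] except in the one block where it may leave [A]. *)
Lemma supp_Fr_uvec A M : valid S A -> A != S -> valid S M ->
  supp (Fr_or_simplex A) (uvec R S M) = (excess (1 < slk S A)%N (apart A M))%:R.
Proof.
move=> vA nA vM; have [j0 j0J] := Slk_neq0 nA.
have pA j := @Slk_proper A j vA; have A0 j (_ : j \in Slk S A) := valid_set_neq0 j vA.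
have sA j (jJ : j \in Slk S A) := fintype.proper_sub (pA j jJ).
have bS j (_ : j \in Slk S A) := block_subset S j.
have [m mM] := boolp.choice (fun i => valid_neq0 i vM).
have ex_a j : exists s, s \in A j /\
    (j \in Slk S A -> (s \notin M j) = (j \in apart A M)).
  case: (boolP (j \in apart A M)) => [|njT].
    rewrite inE => /andP[jJ /eqP AM]; have [s sA'] := valid_neq0 j vA.
    exists s; split=> // _; apply/negP => sM.
    by move/setP: AM => /(_ s); rewrite !inE sA' sM.
  case: (boolP (j \in Slk S A)) => [jJ|njJ]; last first.
    by have [s sA'] := valid_neq0 j vA; exists s.
  move: njT; rewrite inE jJ => /finset.set0Pn[s]; rewrite inE => /andP[sA' sM].
  by exists s; split=> // _; rewrite sM.
have [a aP] := boolp.choice ex_a.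
have apartE g j : j \in Slk S A -> g j \in A j ->
    ((j \in apart A M) <= (g j \notin M j))%N.
  move=> jJ gA; case: (boolP (j \in apart A M)) => //; rewrite inE => /andP[_ /eqP AM].
  case: (boolP (g j \in M j)) => // gM.
  by move/setP: AM => /(_ (g j)); rewrite !inE gA gM.
have cardT : #|apart A M| = (\sum_(j in Slk S A) (j \in apart A M))%N.
  rewrite -sum1_card big_mkcond [RHS]big_mkcond; apply: eq_bigr => j _.
  by rewrite !inE; case: (j \in Slk S A) => //=; case: (_ == _).
rewrite /Fr_or_simplex; case: ifPn => [_|_]; last first.
  have blf g : adm (Slk S A) A A g -> forall j, j \in Slk S A -> bl (g j) = j.
    by move=> ga j; apply: (adm_bl injS partS sA sA).
  have fa : adm (Slk S A) A A [ffun j => a j].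
    apply/admP; exists j0; split=> // [|j _ _]; rewrite ffunE; exact: (aP _).1.
  have fE : (\sum_(j in Slk S A) ([ffun j => a j] j \notin M j) = #|apart A M|)%N.
    by rewrite cardT; apply: eq_bigr => j jJ; rewrite ffunE (aP j).2.
  rewrite (supp_mixed fa) => [|g ga].
    by rewrite sum_uvec // ?fE /excess /= ?subn0 //; apply: blf.
  rewrite !sum_uvec //; try exact: blf.
  rewrite ler_nat fE cardT; apply: leq_sum => j jJ; apply: apartE => //.
  have [i [iJ gi gA]] := admP _ _ _ _ ga.
  by have [->|/gA->] := eqVneq j i.
rewrite (Fr_mixed R injS partS j0J pA A0).
have blf g : adm (Slk S A) S A g -> forall j, j \in Slk S A -> bl (g j) = j.
  by move=> ga j; apply: (adm_bl injS partS bS sA).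
have [i [iJ iT]] : exists i, i \in Slk S A /\
    (i \in apart A M) = (apart A M != finset.set0).
  have [T0|] := eqVneq (apart A M) finset.set0.
    by exists j0; split=> //; rewrite T0 finset.in_set0.
  by move=> /finset.set0Pn[i iT]; exists i; rewrite iT; move: iT; rewrite inE => /andP[].
pose f := [ffun j => if j == i then m i else a j] : {ffun 'I_k -> 'I_n}.
have fa : adm (Slk S A) S A f.
  apply/admP; exists i; split=> [//||j jJ ji]; rewrite ffunE ?eqxx.
    exact: in_valid vM (mM i).
  by rewrite (negbTE ji) (aP j).1.
have exc : excess true (apart A M) = (\sum_(j in Slk S A | j != i) (j \in apart A M))%N.
  by rewrite /excess cardT (bigD1 i) //= iT addKn.
have fE : (\sum_(j in Slk S A) (f j \notin M j) = excess true (apart A M))%N.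
  rewrite exc (bigD1 i) //= ffunE eqxx mM /= add0n; apply: eq_bigr => j /andP[jJ ji].
  by rewrite ffunE (negbTE ji) (aP j).2.
rewrite (supp_mixed fa) => [|g ga].
  by rewrite sum_uvec ?fE //; apply: blf.
rewrite !sum_uvec //; try exact: blf.
rewrite ler_nat fE; have [l [lJ gl gA]] := admP _ _ _ _ ga.
rewrite [leqRHS](bigD1 l) //=.
apply: leq_trans
  (_ : (\sum_(j in Slk S A | j != l) (j \in apart A M) <= _)%N); last first.
  apply: leq_trans (leq_addl _ _); apply: leq_sum => j /andP[jJ jl].
  by apply: apartE => //; apply: gA.
have := cardT; rewrite (bigD1 l) //= /excess => ->.
have : (l \in apart A M) -> apart A M != finset.set0.
  by move=> lT; apply/finset.set0Pn; exists l.
case: (l \in _) => [/(_ isT) ->|_] /=; first by rewrite addKn.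
exact: leq_subr.
Qed.

Lemma supp_simplex_uvec i M : valid S M -> supp (simplex R (S i)) (uvec R S M) = 0.
Proof.
move=> vM; have [s sM] := valid_neq0 i vM; have sS := in_valid vM sM.
have bs : bl s = i by apply/eqP; rewrite -(in_block injS).
rewrite (supp_simplex sS) => [|t _]; first by rewrite (uvecE R injS partS) // bs sM.
by rewrite !(uvecE R injS partS) // bs sM ler0n.
Qed.

Lemma supp_simplex_eblock i j : supp (simplex R (S i)) (eblock R S j) = (i == j)%:R.
Proof.
have [s sS] := block_neq0 partS i; have bs := sS; rewrite (in_block injS partS) in bs.
rewrite (supp_simplex sS) => [|t]; first by rewrite (eblockE R injS partS) (eqP bs).
by rewrite !(eblockE R injS partS) (in_block injS partS) (eqP bs) => /eqP ->.
Qed.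

(** The tuples of the proper faces; they index the rays of the fan. *)
Definition face_tuples : {pred tuples} := [pred A | valid S A && (A != S)].

(** The rays of the fan together with the generators of its lineality space:
    one index for each dimension of the space of piecewise linear functions. *)
Definition basis_index := ({A | A \in face_tuples} + 'I_k)%type.

(** The support functions of a family [P] indexed by the rays, and those of the
    simplices on whole blocks. *)
Definition basis_fun (P : tuples -> set 'rV[R]_n) (t : basis_index) : 'rV[R]_n -> R^o :=
  match t with inl A => supp (P (val A)) | inr i => supp (simplex R (S i)) end.

(** The block simplices vanish on the rays and are dual to the [e_(S_i)], so it
    is enough that the values of [P] on the rays be independent. *)
Lemma family_basis (P : tuples -> set 'rV[R]_n) :
  (forall A, valid S A -> A != S -> simultaneous_min S (P A)) ->
  (forall c : tuples -> R, (forall M, valid S M ->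
     \sum_(A in face_tuples) c A * supp (P A) (uvec R S M) = 0) ->
     forall A, A \in face_tuples -> c A = 0) ->
  is_basis (PL (barycentric_fan R S)) [set basis_fun P t | t in setT].
Proof.
move=> simP indP.
pose pt (t : basis_index) : 'rV[R]_n :=
  match t with inl A => uvec R S (val A) | inr i => eblock R S i end.
have PLb (t : basis_index) : PL (barycentric_fan R S) (basis_fun P t).
  case: t => [A|i]; apply: sim_PL.
    by have /andP[vA nA] := valP A; apply: simP.
  refine (@simplex_sim R _ _ _ injS partS i (S i) _ (block_subset S i)).
  by apply/finset.set0Pn/(block_neq0 partS).
apply: (square_basis (pt := pt)) => //.
- by move=> c; apply: PL_sum.
- by move=> f PLf c; apply: PL_sub => //; apply: PL_sum.
- move=> f PLf f0; apply: (PL_det injS partS) => // [A vA nA|i]; last exact: (f0 (inr i)).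
  have fA : A \in face_tuples by rewrite inE vA.
  exact: (f0 (inl (Sub A fA))).
move=> c c0.
have ev u : \sum_(A : {A | A \in face_tuples}) c (inl A) * supp (P (val A)) u +
    \sum_i c (inr i) * supp (simplex R (S i)) u = 0.
  rewrite -[RHS]/((0 : 'rV[R]_n -> R^o) u) -c0 lin_combE big_sumType /=; by [].
pose c' A := if insub A is Some a then c (inl a) else 0 : R.
have c'0 : forall A, A \in face_tuples -> c' A = 0.
  apply: indP => M vM; rewrite big_sub -[RHS](ev (uvec R S M)).
  rewrite [X in _ = _ + X]big1 ?addr0 => [|i _]; last by rewrite supp_simplex_uvec ?mulr0.
  by apply: eq_bigr => A _; rewrite /c' valK.
have cA (a : {A | A \in face_tuples}) : c (inl a) = 0.
  by rewrite -(c'0 _ (valP a)) /c' valK.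
case=> [A|i]; first exact: cA.
have := ev (eblock R S i); rewrite big1 ?add0r => [|A _]; last by rewrite cA mul0r.
rewrite (bigD1 i) //= supp_simplex_eblock eqxx mulr1 big1 ?addr0 // => j /negbTE ji.
by rewrite supp_simplex_eblock ji mulr0.
Qed.

(** The incidence matrix is triangular: evaluate at a maximal [A]. *)
Lemma DTr_independent (c : tuples -> R) :
  (forall M, valid S M ->
     \sum_(A in face_tuples) c A * supp (DTr S (Slk S A) A) (uvec R S M) = 0) ->
  forall A, A \in face_tuples -> c A = 0.
Proof.
move=> c0 A1 fA1; apply/eqP; apply: contraT => cA1.
have [A /andP[fA cA] Amax] := @arg_maxnP _ A1
  (fun A => (A \in face_tuples) && (c A != 0)) weight (introT andP (conj fA1 cA1)).
have /andP[vA nA] := fA; move/eqP: cA; elim.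
rewrite -(c0 A vA) (bigD1 A) //= supp_DTr_uvec // big1 ?addr0 => [|B /andP[fB nB]].
  have -> : [forall i, A i \subset A i] by apply/forallP => i; apply: fintype.subxx.
  by rewrite mulr1.
have /andP[vB nBS] := fB; rewrite supp_DTr_uvec //.
case: (boolP [forall i, A i \subset B i]) => [/forallP AB|]; last by rewrite mulr0.
have [->|cB] := eqVneq (c B) 0; first by rewrite mul0r.
by case/eqP: nB; rewrite (sub_weight AB (Amax B (introT andP (conj fB cB)))).
Qed.

(** For a minimal [A] in the support of [c], evaluate at the tuples [M K] and
    take the alternating sum over sets [K] of slack blocks of [A]. Any other [B]
    in the support has [B j] not contained in [A j] for some [j], so it meets
    [M K j] whether or not [j] is in [K], and its alternating sum vanishes. *)
Lemma Fr_independent (c : tuples -> R) :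
  (forall M, valid S M ->
     \sum_(A in face_tuples) c A * supp (Fr_or_simplex A) (uvec R S M) = 0) ->
  forall A, A \in face_tuples -> c A = 0.
Proof.
move=> c0 A1 fA1; apply/eqP; apply: contraT => cA1.
have [A /andP[fA cA] Amin] := @arg_minnP _ A1
  (fun A => (A \in face_tuples) && (c A != 0)) weight (introT andP (conj fA1 cA1)).
have /andP[vA nA] := fA; set J := Slk S A.
have [x xA] := boolp.choice (fun j => valid_neq0 j vA).
(* [M K] is the complement of [A] on the slack blocks, to which the point
   [x j] is added when [j] is in [K]. *)
pose M (K : {set 'I_k}) : tuples := [ffun j => if j \in J then
  (S j :\: A j) :|: (if j \in K then [set x j] else finset.set0) else S j]%SET.
have vM K : valid S (M K).
  apply/forallP => j; rewrite ffunE; case: ifPn => jJ; last first.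
    by rewrite fintype.subxx andbT; apply/finset.set0Pn/(block_neq0 partS).
  apply/andP; split.
    have /finset.set0Pn[b bB] := diff_neq0 (fun j => @Slk_proper A j vA) jJ.
    by apply/finset.set0Pn; exists b; rewrite inE bB.
  rewrite finset.subUset finset.subsetDl /=; case: ifP => _; last exact: finset.sub0set.
  by rewrite finset.sub1set (in_valid vA).
have apartA K : apart A (M K) = J :\: K.
  apply/setP => j; rewrite !inE; have -> : (A j != S j) = (j \in J) by rewrite inE.
  case: (boolP (j \in J)) => [jJ|]; last by rewrite andbF.
  rewrite andbT ffunE jJ finset.setIUr finset.setIDA /=.
  have -> : A j :&: S j :\: A j = finset.set0.
    by apply/eqP; rewrite finset.setD_eq0 finset.subsetIl.
  rewrite finset.set0U; case: (j \in K) => /=; last by rewrite finset.setI0 eqxx.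
  by apply/negbTE/finset.set0Pn; exists (x j); rewrite !inE xA eqxx.
pose L B := altsum J (fun K => supp (Fr_or_simplex B) (uvec R S (M K))).
have sumL : \sum_(B in face_tuples) c B * L B = 0.
  rewrite /L /altsum; under eq_bigr => B _ do rewrite mulr_sumr.
  rewrite exchange_big /= big1 // => K _.
  under eq_bigr => B _ do rewrite mulrCA.
  by rewrite -mulr_sumr c0 ?mulr0.
have LA : L A != 0.
  rewrite /L (@eq_altsum _ _ _ _ (fun K => (excess (1 < #|J|)%N (J :\: K))%:R)).
    by apply: altsum_excess; apply/finset.set0Pn; apply: Slk_neq0.
  by move=> K _; rewrite supp_Fr_uvec // apartA.
move: sumL; rewrite (bigD1 A) //= big1 ?addr0 => [/eqP|B /andP[fB nB]].
  by rewrite mulf_eq0 (negbTE cA) (negbTE LA).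
have [->|cB] := eqVneq (c B) 0; first by rewrite mul0r.
have /andP[vB nBS] := fB.
have [j jBA] : exists j, ~~ (B j \subset A j).
  apply: contrapT => /forallNP h; case/eqP: nB; apply: sub_weight.
    by move=> j; apply/negPn/negP/h.
  exact: (Amin B (introT andP (conj fB cB))).
have jJ : j \in J.
  rewrite inE; apply: contraNneq jBA => ->.
  by have /forallP/(_ j)/andP[] := vB.
rewrite /L (altsum_toggle jJ) ?mulr0 // => K _ jK.
rewrite !supp_Fr_uvec //; congr (excess _ _)%:R; apply/setP => i; rewrite !inE.
congr (_ && _); have [->|ij] := eqVneq i j; last by rewrite !ffunE !inE (negbTE ij).
have /fintype.subsetPn[b bB bA] := jBA; have bS := in_valid vB bB.
have nz (K' : {set 'I_k}) : (B j :&: M K' j == finset.set0) = false.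
  apply/negbTE/finset.set0Pn; exists b; rewrite inE bB ffunE jJ !inE bA bS.
  by [].
by rewrite !nz.
Qed.

End Bases.

(** * The two indecomposable polytopal bases *)

Section Assembly.
Local Open Scope ring_scope.
Variables (R : realType) (n k : nat) (S : {ffun 'I_k -> {set 'I_n}}).
Hypotheses (injS : injective S)
  (partS : finset.partition (S @: 'I_k) [set: 'I_n]%SET).
Local Notation tuples := {ffun 'I_k -> {set 'I_n}}.
Implicit Types (A : tuples) (i j : 'I_k) (I : {set 'I_n}) (P Q : tuples -> set 'rV[R]_n).

Lemma slk_gt1_neq A : (1 < slk S A)%N -> A != S.
Proof.
apply: contraTneq => ->; rewrite -leqNgt.
suff -> : slk S S = 0%N by [].
by apply/eqP; rewrite cards_eq0; apply/eqP/setP => j; rewrite !inE eqxx.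
Qed.

Lemma slk1 A : A != S -> (slk S A <= 1)%N -> exists i, Slk S A = [set i]%SET.
Proof.
move=> nA A1; apply/cards1P; rewrite eqn_leq A1 card_gt0.
by apply/finset.set0Pn; apply: Slk_neq0.
Qed.

Lemma one_block_tuple i I : I != finset.set0 -> I \subset S i -> I != S i ->
  exists A, [/\ A \in face_tuples S, Slk S A = [set i]%SET & A i = I].
Proof.
move=> I0 IS nI; exists [ffun j => if j == i then I else S j].
have SlkE : Slk S [ffun j => if j == i then I else S j] = [set i]%SET.
  apply/setP => j; rewrite !inE ffunE.
  by case: (j =P i) => [->|_]; [rewrite nI | rewrite eqxx].
split=> //; last by rewrite ffunE eqxx.
rewrite inE; apply/andP; split.
  apply/forallP => j; rewrite ffunE; case: (j =P i) => [->|_]; first by rewrite I0.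
  by rewrite fintype.subxx andbT; apply/finset.set0Pn/(block_neq0 partS).
apply/eqP => AS; have : i \in Slk S S by rewrite -[X in Slk S X]AS SlkE inE.
by rewrite inE eqxx.
Qed.

Lemma DTr_slk1 A i : valid S A -> Slk S A = [set i]%SET ->
  DTr S (Slk S A) A = simplex R (S i :\: A i).
Proof.
move=> vA A1; rewrite (DTr_mixed R injS partS (fun j => @Slk_proper n k S A j vA)).
by rewrite A1 mixed_simplex.
Qed.

Lemma simplicial_facts (P : set 'rV[R]_n) : simplicial_family R S P ->
  [/\ is_polytope P, simultaneous_min S P & indecomposable P].
Proof.
move=> [i [I [I0 IS ->]]]; split.
- exact: (simplex_polytope R i I0).
- exact: (simplex_sim R injS partS I0 IS).
- exact: (simplex_indecomposable injS partS I0 IS).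
Qed.

(** [P] is the family of truncations or fragments; [Q] extends it to the
    tuples with one slack block by the simplices on proper subsets of blocks. *)
Lemma family_indecomposable_basis P Q :
  (forall A, valid S A -> (1 < slk S A)%N ->
     [/\ is_polytope (P A), simultaneous_min S (P A), indecomposable (P A)
       & Q A = P A]) ->
  (forall A, A \in face_tuples S -> (slk S A <= 1)%N ->
     simplicial_family R S (Q A)) ->
  (forall i I, I != finset.set0 -> I \subset S i -> I != S i ->
     exists2 A, A \in face_tuples S & Q A = simplex R I) ->
  (forall c : tuples -> R, (forall M, valid S M ->
     \sum_(A in face_tuples S) c A * supp (Q A) (uvec R S M) = 0) ->
     forall A, A \in face_tuples S -> c A = 0) ->
  indecomposable_polytopal_basis (barycentric_fan R S)
    ([set P A | A in [set A | valid S A /\ (1 < slk S A)%N]]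
       `|` simplicial_family R S).
Proof.
move=> PQ Q1 Qsimplex indQ; set F := _ `|` _.
have FP X : F X -> [/\ is_polytope X, simultaneous_min S X & indecomposable X].
  case=> [[A [vA A2] <-]|/simplicial_facts //].
  by have [] := PQ A vA A2.
split; last by move=> X /FP[].
split=> [X /FP[polX simX _]|]; first by split=> //; apply: (sim_coarsens injS partS).
have -> : [set supp X | X in F] = [set basis_fun Q t | t in [set: basis_index S]].
  apply/seteqP; split=> [_ [X FX <-]|_ [[[A fA]|i] _ <-] /=].
  - case: FX => [[A [vA A2] <-]|[i [I [I0 IS ->]]]].
      have fA : A \in face_tuples S by rewrite inE vA slk_gt1_neq.
      exists (inl (exist _ A fA)) => //=; by have [_ _ _ ->] := PQ A vA A2.
    have [->|nI] := eqVneq I (S i); first by exists (inr i).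
    have [A fA QA] := Qsimplex i I I0 IS nI.
    by exists (inl (exist _ A fA)) => //=; rewrite QA.
  - exists (Q A) => //; have [A1|A2] := leqP (slk S A) 1; first by right; apply: Q1.
    have /andP[vA _] := fA; left; exists A => //.
    by have [_ _ _ ->] := PQ A vA A2.
  - exists (simplex R (S i)) => //; right; exists i, (S i); split=> //.
    exact/finset.set0Pn/(block_neq0 partS).
apply: (family_basis injS partS) => // A vA nA.
have fA : A \in face_tuples S by rewrite inE vA.
have [A1|A2] := leqP (slk S A) 1; first by have [] := simplicial_facts (Q1 A fA A1).
by have [_ simA _ ->] := PQ A vA A2.
Qed.

Lemma DTr_basis : indecomposable_polytopal_basis (barycentric_fan R S)
  (DTr_family R S `|` simplicial_family R S).
Proof.
apply: (@family_indecomposable_basis _ (fun A => DTr S (Slk S A) A)).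
- move=> A vA A2; have [j0 j0J] := Slk_neq0 (slk_gt1_neq A2).
  have pA j := @Slk_proper n k S A j vA.
  have A0 j (_ : j \in Slk S A) := valid_set_neq0 j vA.
  split=> //.
  + exact: (DTr_polytope R injS partS j0J pA A0).
  + exact: (DTr_sim R injS partS j0J pA A0).
  + exact: (DTr_indecomposable injS partS j0J pA A0).
- move=> A /andP[vA nA] A1; have [i Ai] := slk1 nA A1.
  exists i, (S i :\: A i); split; last exact: DTr_slk1.
    have iA : i \in Slk S A by rewrite Ai inE.
    exact: (diff_neq0 (fun j => @Slk_proper n k S A j vA) iA).
  exact: finset.subsetDl.
- move=> i I I0 IS nI.
  have [||| A [fA A1 Ai]] := @one_block_tuple i (S i :\: I).
  + by rewrite finset.setD_eq0; apply: contraNN nI => SI; rewrite finset.eqEsubset IS.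
  + exact: finset.subsetDl.
  + have /finset.set0Pn[s sI] := I0; apply/eqP => /setP/(_ s).
    by rewrite !inE sI (fintype.subsetP IS).
  have /andP[vA _] := fA; exists A => //; rewrite (DTr_slk1 vA A1) Ai.
  by rewrite finset.setDDr finset.setDv finset.set0U (finset.setIidPr IS).
- exact: (DTr_independent injS partS).
Qed.

Lemma Fr_basis : indecomposable_polytopal_basis (barycentric_fan R S)
  (Fr_family R S `|` simplicial_family R S).
Proof.
apply: (@family_indecomposable_basis (fun A => Fr S (Slk S A) A)
  (fun A => Fr_or_simplex S A)).
- move=> A vA A2; have [j0 j0J] := Slk_neq0 (slk_gt1_neq A2).
  have pA j := @Slk_proper n k S A j vA.
  have A0 j (_ : j \in Slk S A) := valid_set_neq0 j vA.
  split.
  + exact: (Fr_polytope R injS partS j0J pA A0).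
  + exact: (Fr_sim R injS partS j0J pA A0).
  + exact: (Fr_indecomposable injS partS j0J pA A0).
  + by rewrite /Fr_or_simplex A2.
- move=> A /andP[vA nA] A1; have [i Ai] := slk1 nA A1.
  exists i, (A i); rewrite /Fr_or_simplex ltnNge A1 Ai mixed_simplex.
  by have /forallP/(_ i)/andP[] := vA.
- move=> i I I0 IS nI; have [A [fA A1 Ai]] := one_block_tuple I0 IS nI.
  by exists A => //; rewrite /Fr_or_simplex /slk A1 cards1 mixed_simplex Ai.
- exact: (Fr_independent injS partS).
Qed.

End Assembly.

Theorem theorem1p4 (R : realType) (n k : nat)
    (S : {ffun 'I_k -> {set 'I_n}})
    (injS : injective S)
    (partS : finset.partition (S @: 'I_k) [set: 'I_n]%SET) :
  indecomposable_polytopal_basis (barycentric_fan R S)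
    (DTr_family R S `|` simplicial_family R S) /\
  indecomposable_polytopal_basis (barycentric_fan R S)
    (Fr_family R S `|` simplicial_family R S).
Proof. by split; [apply: DTr_basis | apply: Fr_basis]. Qed.
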